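(* Let $n\geq 12$ be an even integer. Among all binary trees on $n$ vertices, the distance between center and subtree core is maximized by a crg tree; that is, there is a crg tree $T^*$ on $n$ vertices such that $d_T(C(T),S_c(T))\leq d_{T^*}(C(T^* ),S_c(T^* ))$ for every binary tree $T$ on $n$ vertices.
   Context: All graphs are finite, simple, connected and undirected. A pendant vertex is a vertex of degree $1$. A binary tree is a tree in which every non-pendant vertex has degree $3$ (so its number of vertices is even). Center and subtree core: the eccentricity of $v\in V(T)$ is $e(v)=\max_{u}d_T(u,v)$; the center $C(T)$ is the set of vertices of minimum eccentricity. A subtree of $T$ is a (nonempty) connected subgraph of $T$; $f_T(v)$ is the number of subtrees of $T$ containing $v$; the subtree core $S_c(T)$ is the set of vertices $v$ for which $f_T(v)$ is maximum. For $X,Y\subseteq V(T)$, $d_T(X,Y)=\min\{d_T(x,y):x\in X,y\in Y\}$. Rooted binary trees: a rooted binary tree is a rooted tree whose root has degree $2$ and in which every other vertex has degree $1$ or $3$; the single-vertex rooted tree is also allowed. The height (level) of a vertex is its distance to the root. A rooted binary tree is ordered if the vertices of each level $l\ge 1$ are linearly ordered so that two vertices at level $l+1$ with different parents are ordered as their parents are at level $l$. A rooted binary tree is rgood if (i) the heights of any two of its pendant vertices differ by at most $1$, and (ii) it can be ordered so that the parents of the pendant vertices at the highest level form a final segment in the ordering of the vertices at the next-to-highest level. For each odd $l$ there is, up to isomorphism, exactly one rgood binary tree on $l$ vertices, denoted $T_{rg}^l$. Crg trees: a binary caterpillar is a binary tree having a path such that every vertex not on the path is adjacent to a vertex of the path.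 For even $n\ge 4$ and odd $l$ with $3\le l<n$, the crg tree $T_{rg}^{n,l}$ is the tree on $n$ vertices obtained by identifying the root of $T_{rg}^l$ with a vertex of maximum eccentricity of a binary caterpillar on $n-l+1$ vertices. *)

(* Defs.v *)
From mathcomp Require Import all_boot.
Set Implicit Arguments.
Unset Strict Implicit.
Unset Printing Implicit Defensive.

Record sgraph := SGraph {
  vertex :> finType;
  adj : rel vertex;
  adj_sym : symmetric adj;
  adj_irr : irreflexive adj }.

Section Graphs.
Variable G : sgraph.
Implicit Types (u v x y : G) (X Y : {set G}).

Definition degree v : nat := #|[set u | adj v u]|.
Definition pendant v : bool := degree v == 1.

Definition walk_of_length x y (k : nat) : bool :=
  [exists p : k.-tuple G, path (@adj G) x p && (last x p == y)].

(* Least length of a walk from x to y; the junk value #|G| is returned exactly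
   when there is none (a shortest walk has fewer than #|G| edges). *)
Definition dist x y : nat := find (walk_of_length x y) (iota 0 #|G|).

(* The junk value #|G| exceeds every distance in a connected graph. *)
Definition dist_set X Y : nat :=
  \big[minn/#|G|]_(x in X) \big[minn/#|G|]_(y in Y) dist x y.

Definition ecc v : nat := \max_(u : G) dist u v.
Definition center : {set G} := [set v | [forall u, ecc v <= ecc u]].

Definition is_tree : Prop :=
  [/\ 0 < #|G|,
      forall x y, connect (@adj G) x y
    & forall c : seq G, 2 < size c -> ~ ucycle (@adj G) c].

Definition binary_tree : Prop :=
  is_tree /\ forall v, ~~ pendant v -> degree v = 3.

(* A subgraph is a pair (W, F) of a vertex set W and a set F of edges of G with
   both endpoints in W, an edge being the unordered pair [set x; y]. *)
Definition edges : {set {set G}} :=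
  [set [set xy.1; xy.2] | xy : G * G & adj xy.1 xy.2].

Definition is_subgraph (H : {set G} * {set {set G}}) : bool :=
  (H.2 \subset edges) && [forall e in H.2, e \subset H.1].

Definition is_subtree (H : {set G} * {set {set G}}) : bool :=
  [&& is_subgraph H, H.1 != set0
    & [forall x in H.1, forall y in H.1,
         connect (fun a b : G => [set a; b] \in H.2) x y]].

Definition num_subtrees v : nat :=
  #|[set H : {set G} * {set {set G}} | is_subtree H && (v \in H.1)]|.

Definition subtree_core : {set G} :=
  [set v | [forall u, num_subtrees u <= num_subtrees v]].

Definition center_core_dist : nat := dist_set center subtree_core.

Definition binary_caterpillar : Prop :=
  binary_tree /\
  exists x (p : seq G),
    [/\ path (@adj G) x p, uniq (x :: p)
      & forall v, v \notin x :: p -> exists2 u, u \in x :: p & adj v u].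

Section Rooted.
Variable r : G.

Definition height v : nat := dist r v.
Definition top_level : nat := \max_(v : G) height v.
Definition is_parent u v : bool := adj u v && (height v == (height u).+1).

Definition rooted_binary_tree : Prop :=
  is_tree /\
  (#|G| = 1 \/
   degree r = 2 /\ forall v, v != r -> degree v = 1 \/ degree v = 3).

(* le is only meaningful between vertices of a same level l >= 1. *)
Definition ordering (le : rel G) : Prop :=
  (forall l, 0 < l ->
     [/\ {in [pred v | height v == l], reflexive le},
         {in [pred v | height v == l] &, antisymmetric le},
         {in [pred v | height v == l] & &, transitive le}
       & {in [pred v | height v == l] &, total le}]) /\
  (forall l u v pu pv, 0 < l ->
     height u = l.+1 -> height v = l.+1 ->
     is_parent pu u -> is_parent pv v -> pu != pv ->
     le u v = le pu pv).

Definition parent_of_top u : bool :=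
  [exists v, [&& pendant v, height v == top_level & is_parent u v]].

Definition rgood : Prop :=
  [/\ rooted_binary_tree,
      forall u v, pendant u -> pendant v -> height u <= (height v).+1
    & exists2 le : rel G, ordering le
        & forall u v, (height u).+1 = top_level -> (height v).+1 = top_level ->
            parent_of_top u -> le u v -> parent_of_top v].

End Rooted.
End Graphs.

Definition isomorphic (G H : sgraph) : Prop :=
  exists2 f : G -> H, bijective f & forall x y, adj (f x) (f y) = adj x y.

(* Disjoint union of G and H with y : H identified with x : G. *)
Section Glue.
Variables (G : sgraph) (x : G) (H : sgraph) (y : H).

Definition glue_vertex : finType := (G + {z : H | z != y})%type.

Definition glue_adj (a b : glue_vertex) : bool :=
  match a, b with
  | inl u, inl v => adj u v
  | inr u, inr v => adj (val u) (val v)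
  | inl u, inr v => (u == x) && adj y (val v)
  | inr u, inl v => (v == x) && adj (val u) y
  end.

Lemma glue_adj_sym : symmetric glue_adj.
Proof. by move=> [a|a] [b|b] /=; rewrite adj_sym. Qed.

Lemma glue_adj_irr : irreflexive glue_adj.
Proof. by move=> [a|a] /=; rewrite adj_irr. Qed.

Definition glue : sgraph := SGraph glue_adj_sym glue_adj_irr.
End Glue.

Definition crg_tree (n l : nat) (S : sgraph) : Prop :=
  [/\ ~~ odd n, 4 <= n, odd l, 3 <= l < n
    & exists (R : sgraph) (r : R) (K : sgraph) (k : K),
        [/\ rgood r /\ #|R| = l,
            binary_caterpillar K /\ #|K| = n - l + 1,
            (forall v : K, ecc v <= ecc k)
          & isomorphic S (glue r k)]].

(* Main.v *)
Require Import Defs.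
From mathcomp Require Import all_boot zify.
Set Implicit Arguments.
Unset Strict Implicit.
Unset Printing Implicit Defensive.

(* Let s in the core and c in the center of T realize D = d(C(T), S_c(T)) > 0, let
   v be the neighbour of s towards c, and let A (containing s) and B (containing v)
   be the components of T - sv.  Since v is not in the core, A has more subtrees
   through its root than B; since the neighbour of c towards s is not central,
   height B + 1 >= height A + 2 D.  Conversely these two inequalities force a
   distance at least D.  Among rooted binary trees with given numbers of vertices,
   the rgood tree has both the most root subtrees and the least height, while the
   caterpillar has both the fewest root subtrees and the largest height; replacing
   A and B by them therefore keeps both inequalities and yields a crg tree. *)

(** * Shapes of rooted binary trees *)

(** The extremal facts concern unlabelled shapes, so they are proved for [btree]; graphs enter only
    through the shapes on the two sides of an edge. The hard fact is that the rgood shape has the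
    most root subtrees. By induction on the number of leaves both root branches [x] and [y] may be
    taken rgood, so only the split of the leaves between them is open. If at an optimal split they
    do not fit together into an rgood tree, then either a child of [x] is larger than [y] and
    trading the two gains, or both have an incomplete last level. In that case there are siblings
    [p], [s] inside [x] and [q], [r] inside [y] with [p] smaller than [q] and [r] smaller than [s],
    and exchanging [p] with [q] increases the product of the weights. The term 2 D arises because,
    in the caterpillar, moving an edge one step from the core towards the center lowers the side
    ahead by one and raises the side behind by one. The rgood tree is realized as a binary heap,
    whose indices make levels and ordering explicit; the size of the rgood part is then chosen by
    maximizing over finitely many values. *)

Inductive btree := Leaf | Node of btree & btree.

Fixpoint leaves t := if t is Node a b then leaves a + leaves b else 1.
Fixpoint depth t := if t is Node a b then (maxn (depth a) (depth b)).+1 else 0.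
(** One more than the number of subtrees containing the root, the extra unit standing for the empty
    choice. At a node the choices in the two branches multiply, and [.+1] restores the empty
    choice. *)
Fixpoint weight t := if t is Node a b then (weight a * weight b).+1 else 2.

Lemma leavesN a b : leaves (Node a b) = leaves a + leaves b.
Proof. by []. Qed.

Lemma leaves_gt0 t : 0 < leaves t.
Proof. by elim: t => //= a Ha b _; lia. Qed.

Lemma weight_ge2 t : 2 <= weight t.
Proof. elim: t => //= a Ha b Hb; nia. Qed.

Lemma leaves_le_exp_depth t : leaves t <= 2 ^ depth t.
Proof.
elim: t => //= a Ha b Hb; rewrite expnS mul2n -addnn leq_add //.
  by apply: leq_trans Ha _; rewrite leq_exp2l // leq_maxl.
by apply: leq_trans Hb _; rewrite leq_exp2l // leq_maxr.
Qed.

Lemma depth_lt_leaves t : depth t < leaves t.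
Proof. elim: t => //= a Ha b Hb; lia. Qed.

Fixpoint comb m := if m is m'.+1 then Node Leaf (comb m') else Leaf.

Lemma leaves_comb m : leaves (comb m) = m.+1.
Proof. by elim: m => //= m ->. Qed.

Lemma depth_comb m : depth (comb m) = m.
Proof. by elim: m => //= m ->; rewrite max0n. Qed.

Lemma weight_comb m : (weight (comb m)).+1 = 3 * 2 ^ m.
Proof. by elim: m => //= m IH; rewrite expnS; lia. Qed.

(** With [x = 2 ^ i] and [y = 2 ^ j], a node over two combs has weight [(3x - 1)(3y - 1) + 1], a
    single comb with as many leaves [6xy - 1]; the difference is [3(x - 1)(y - 1)]. *)
Lemma weight_ge_comb t m : leaves t = m.+1 -> weight (comb m) <= weight t.
Proof.
elim: t m => [|a Ha b Hb] m /=; first by case: m.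
move: Ha Hb (leaves_gt0 a) (leaves_gt0 b).
case: (leaves a) => // i; case: (leaves b) => // j.
move=> /(_ i erefl) Ha /(_ j erefl) Hb _ _ Em.
have {Em} -> : m = (i + j).+1 by lia.
have wi := weight_comb i; have wj := weight_comb j.
have := weight_comb (i + j).+1; rewrite expnS expnD => wij.
have pi : 0 < 2 ^ i by rewrite expn_gt0.
have pj : 0 < 2 ^ j by rewrite expn_gt0.
apply: (@leq_trans (weight (comb i) * weight (comb j)).+1); last first.
  by rewrite ltnS leq_mul.
move: wi wj wij pi pj; move: (2 ^ i) (2 ^ j) => x y wi wj wij px py.
nia.
Qed.

(** * Perfect and rgood shapes *)

Fixpoint perfect h t := match h, t with
  | 0, Leaf => true
  | h'.+1, Node a b => perfect h' a && perfect h' b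
  | _, _ => false end.

(** All leaves are at levels [h] and [h.+1], the deeper ones gathered on the left, so at most one
    branch of a node is incomplete. Perfect trees of height [h] and of height [h.+1] both qualify,
    so consecutive indices overlap. *)
Fixpoint good h t := match h, t with
  | 0, _ => perfect 0 t || perfect 1 t
  | h'.+1, Node a b =>
      perfect h'.+1 a && good h' b || good h' a && perfect h' b
  | _, _ => false end.

Lemma perfectS h a b : perfect h.+1 (Node a b) = perfect h a && perfect h b.
Proof. by []. Qed.

Lemma goodS h a b : good h.+1 (Node a b) =
  perfect h.+1 a && good h b || good h a && perfect h b.
Proof. by []. Qed.

Lemma perfect_leaves h t : perfect h t -> leaves t = 2 ^ h.
Proof.
elim: h t => [|h IH] [|a b] //= /andP[/IH -> /IH ->].
by rewrite expnS; lia.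
Qed.

Lemma perfect_depth h t : perfect h t -> depth t = h.
Proof. by elim: h t => [|h IH] [|a b] //= /andP[/IH -> /IH ->]; rewrite maxnn. Qed.

Lemma perfect_inj h t u : perfect h t -> perfect h u -> t = u.
Proof.
elim: h t u => [|h IH] [|a b] [|c d] //= /andP[pa pb] /andP[pc pd].
by rewrite (IH _ _ pa pc) (IH _ _ pb pd).
Qed.

Lemma perfect_good h t : perfect h t -> good h t.
Proof.
elim: h t => [|h IH] [|a b] //; rewrite perfectS => /andP[/IH ga pb].
by rewrite goodS ga pb orbT.
Qed.

Lemma perfectS_good h t : perfect h.+1 t -> good h t.
Proof.
elim: h t => [|h IH] [|a b] //.
by rewrite perfectS => /andP[pa /IH gb]; rewrite goodS pa gb.
Qed.

Lemma good_leaves h t : good h t -> 2 ^ h <= leaves t <= 2 ^ h.+1.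
Proof.
elim: h t => [|h IH] t; first by case/orP=> /perfect_leaves ->.
case: t => // a b; rewrite goodS => /orP[] /andP[].
  by move=> /perfect_leaves /= -> /IH; rewrite !expnS; lia.
by move=> /IH + /perfect_leaves /= ->; rewrite !expnS; lia.
Qed.

Lemma good_low h t : good h t -> leaves t = 2 ^ h -> perfect h t.
Proof.
elim: h t => [|h IH] t; first by case/orP=> // /perfect_leaves ->.
case: t => // a b; rewrite goodS => /orP[] /andP[].
  move=> /perfect_leaves /= -> /good_leaves; rewrite !expnS.
  by have := expn_gt0 2 h; lia.
move=> /IH + pb /=; rewrite pb (perfect_leaves pb) expnS => + E.
by move=> -> //; lia.
Qed.

Lemma good_high h t : good h t -> leaves t = 2 ^ h.+1 -> perfect h.+1 t.
Proof.
elim: h t => [|h IH] t; first by case/orP=> // /perfect_leaves ->.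
case: t => // a b; rewrite goodS => /orP[] /andP[].
  move=> pa /IH; rewrite perfectS pa leavesN.
  rewrite (perfect_leaves pa) !expnS => + E.
  by move=> -> //; lia.
move=> /good_leaves + /perfect_leaves /=; rewrite !expnS.
by have := expn_gt0 2 h; lia.
Qed.

Lemma good_inj1 h t u : good h t -> good h u -> leaves t = leaves u -> t = u.
Proof.
elim: h t u => [|h IH] t u.
  case/orP=> pt /orP[] pu; rewrite ?(perfect_leaves pt) ?(perfect_leaves pu) //.
    by move=> _; apply: perfect_inj pt pu.
  by move=> _; apply: perfect_inj pt pu.
case: t => // a b; case: u => // c d.
(* If the left branch is full in one tree and the right branch is minimal in the other, equal leaf
   counts force both onto the common boundary of [3 * 2 ^ h] leaves. *)
have mixed a' b' c' d' : perfect h.+1 a' -> good h b' -> good h c' ->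
    perfect h d' -> leaves a' + leaves b' = leaves c' + leaves d' ->
    Node a' b' = Node c' d'.
  move=> pa gb gc pd; rewrite (perfect_leaves pa) (perfect_leaves pd) => E.
  have pb : perfect h b'.
    apply: good_low => //; move: (good_leaves gb) (good_leaves gc) E.
    by rewrite !expnS; lia.
  have pc : perfect h.+1 c'.
    apply: good_high => //; move: (good_leaves gb) (good_leaves gc) E.
    by rewrite !expnS; lia.
  by rewrite (perfect_inj pa pc) (perfect_inj pb pd).
rewrite !goodS => /orP[] /andP[ga gb] /orP[] /andP[gc gd] /= E.
- have Eac := perfect_inj ga gc; rewrite Eac in E *.
  by rewrite (IH b d) //; lia.
- exact: mixed.
- by symmetry; apply: mixed.
have Ebd := perfect_inj gb gd; rewrite Ebd in E *.
by rewrite (IH a c) //; lia.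
Qed.

(** For different heights the ranges from [2 ^ h] to [2 ^ h.+1] leaves meet at most in an endpoint,
    where both trees are perfect. *)
Lemma good_inj h k t u : good h t -> good k u -> leaves t = leaves u -> t = u.
Proof.
wlog hk : h k t u / h <= k => [W gt gu E|].
  case/orP: (leq_total h k) => hk; first exact: (W h k).
  by symmetry; apply: (W k h).
move=> gt gu E; move: hk; rewrite leq_eqVlt => /orP[/eqP hk|hk].
  by rewrite -hk in gu; apply: good_inj1 gt gu E.
have lt := good_leaves gt; have lu := good_leaves gu.
have le : 2 ^ h.+1 <= 2 ^ k by rewrite leq_exp2l.
have E1 : leaves t = 2 ^ h.+1 by lia.
have E2 : leaves u = 2 ^ k by lia.
have hk' : h.+1 = k by apply/eqP; rewrite -(eqn_exp2l _ _ (isT : 1 < 2)) -E1 -E2 E.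
have := good_low gu E2; rewrite -hk' => pu.
exact: perfect_inj (good_high gt E1) pu.
Qed.

Lemma good_depth_le h t u : good h t -> leaves u = leaves t -> depth t <= depth u.
Proof.
move=> gt E; have := leaves_le_exp_depth u; rewrite E.
have /andP[] := good_leaves gt.
rewrite leq_eqVlt => /orP[/eqP E1 _|lt _ le].
  have pt := good_low gt (esym E1).
  by rewrite (perfect_depth pt) -E1 leq_exp2l.
have : h < depth u by rewrite -(ltn_exp2l _ _ (isT : 1 < 2)) (leq_trans lt).
apply: leq_trans; move: gt {E lt le}; elim: h t => [|h IH] t.
  by case/orP=> /perfect_depth ->.
case: t => // a b; rewrite goodS => /orP[] /andP[].
  by move=> /perfect_depth Ea /IH Eb /=; lia.
by move=> /IH Ea /perfect_depth Eb /=; lia.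
Qed.

Fixpoint perf h := if h is h'.+1 then Node (perf h') (perf h') else Leaf.

Lemma perfect_perf h : perfect h (perf h).
Proof. by elim: h => //= h ->. Qed.

(** The right branch holds at least [2 ^ h'] leaves and the left one at most [2 ^ h'.+1], so the
    left branch is full from [3 * 2 ^ h'] leaves on. *)
Fixpoint mkgood h k :=
  if h is h'.+1 then
    if 3 * 2 ^ h' <= k then Node (perf h'.+1) (mkgood h' (k - 2 ^ h'.+1))
    else Node (mkgood h' (k - 2 ^ h')) (perf h')
  else if k <= 1 then Leaf else Node Leaf Leaf.

Lemma mkgoodP h k : 2 ^ h <= k <= 2 ^ h.+1 ->
  good h (mkgood h k) /\ leaves (mkgood h k) = k.
Proof.
elim: h k => [|h IH] k; last move=> Hk.
  by rewrite expn0 expn1 => Hk /=; case: (leqP k 1) => ?; split=> //=; lia.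
rewrite [mkgood _ _]/=; case: (leqP (3 * 2 ^ h) k) => H3.
  rewrite -[Node (perf h) (perf h)]/(perf h.+1).
  have [|g l] := IH (k - 2 ^ h.+1); first by move: Hk H3; rewrite !expnS; lia.
  have p := perfect_perf h.+1; rewrite goodS p g; split=> //.
  by move: H3; rewrite leavesN (perfect_leaves p) l expnS; lia.
have [|g l] := IH (k - 2 ^ h); first by move: Hk H3; rewrite !expnS; lia.
have p := perfect_perf h; rewrite goodS p g orbT; split=> //.
by move: Hk; rewrite leavesN (perfect_leaves p) l expnS; lia.
Qed.

Definition best k := mkgood (trunc_log 2 k) k.

Lemma bestP k : 0 < k -> good (trunc_log 2 k) (best k) /\ leaves (best k) = k.
Proof. by move=> k0; apply: mkgoodP; rewrite trunc_logP //= ltnW // trunc_log_ltn. Qed.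

Lemma good_best h t : good h t -> t = best (leaves t).
Proof. by move=> g; have [g' E] := bestP (leaves_gt0 t); apply: good_inj g g' _. Qed.

(** * Rgood shapes maximize the weight: exchange arguments *)

Inductive sibling : btree -> btree -> btree -> Prop :=
  | sibling_l p s : sibling (Node p s) p s
  | sibling_r p s : sibling (Node s p) p s
  | sibling_liftl x z p s : sibling x p s -> sibling (Node x z) p s
  | sibling_liftr x z p s : sibling x p s -> sibling (Node z x) p s.

Lemma sibling_sym x p s : sibling x p s -> sibling x s p.
Proof.
by elim=> *; [apply: sibling_r | apply: sibling_l | apply: sibling_liftl
             | apply: sibling_liftr].
Qed.

(* As a function of the subtree put in place of [p], the weight of [x] is affine.
   The bounds say [1 / weight s <= X0 / X1 < 2 / weight s]: the sibling of [p]
   alone essentially decides how much replacing [p] pays off. *)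
Lemma sibling_affine x p s : sibling x p s -> exists X0 X1,
  [/\ weight x = X0 + X1 * weight p,
      weight s * X0 + weight s <= 2 * X1,
      X1 <= weight s * X0, 0 < X1
    & forall p', exists2 x', leaves x' + leaves p = leaves x + leaves p'
                           & weight x' = X0 + X1 * weight p'].
Proof.
elim=> [{}p {}s|{}p {}s|{}x z {}p {}s _ IH|{}x z {}p {}s _ IH].
- have s2 := weight_ge2 s; exists 1, (weight s); split=> /=; try lia.
  by move=> p'; exists (Node p' s) => /=; lia.
- have s2 := weight_ge2 s; exists 1, (weight s); split=> /=; try lia.
  by move=> p'; exists (Node s p') => /=; lia.
- have [X0 [X1 [E H1 H2 H3 H4]]] := IH; have z2 := weight_ge2 z.
  exists (1 + weight z * X0), (weight z * X1); split; rewrite /= ?E; try nia.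
  move=> p'; have [x' l w] := H4 p'; exists (Node x' z) => /=; first by lia.
  by rewrite w; nia.
have [X0 [X1 [E H1 H2 H3 H4]]] := IH; have z2 := weight_ge2 z.
exists (1 + weight z * X0), (weight z * X1); split; rewrite /= ?E; try nia.
move=> p'; have [x' l w] := H4 p'; exists (Node z x') => /=; first by lia.
by rewrite w; nia.
Qed.

(** Exchanging [p] and [q] changes the product of the two affine functions by [(X1 * Y0 - X0 * Y1) *
    (weight q - weight p)]. The first factor is positive because [X0 / X1 < 2 / weight s <= 1 /
    weight r <= Y0 / Y1]. *)
Lemma sibling_swap x p s y q r : sibling x p s -> sibling y q r ->
    2 * weight r <= weight s -> weight p < weight q ->
  exists x' y', [/\ leaves x' + leaves y' = leaves x + leaves y
                  & weight x * weight y < weight x' * weight y'].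
Proof.
move=> /sibling_affine[X0 [X1 [Ex H1 _ X1p Hx]]].
move=> /sibling_affine[Y0 [Y1 [Ey _ H2 Y1p Hy]]] rs pq.
have [x' lx wx] := Hx q; have [y' ly wy] := Hy p.
exists x', y'; split; first by lia.
rewrite Ex Ey wx wy.
have s2 := weight_ge2 s.
have key : X0 * Y1 < X1 * Y0.
  rewrite -(ltn_pmul2l (_ : 0 < weight s)); last by lia.
  have a1 : (weight s * X0 + weight s) * Y1 <= 2 * X1 * Y1 by rewrite leq_mul2r H1 orbT.
  have a2 : 2 * X1 * Y1 <= 2 * X1 * (weight r * Y0) by rewrite leq_mul2l H2 orbT.
  have a3 : 2 * weight r * (X1 * Y0) <= weight s * (X1 * Y0) by rewrite leq_mul2r rs orbT.
  have a4 : 0 < weight s * Y1 by rewrite muln_gt0 Y1p; lia.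
  lia.
nia.
Qed.

(** On the way down through the incomplete subtrees, each has one perfect and one incomplete child,
    until both children are perfect, with [2 ^ m] and [2 ^ m.+1] leaves. The subtrees passed supply
    the sibling pairs for the other [M], which is thus a level counted from below. *)
Lemma sibling_levels h t : good h t -> 2 ^ h < leaves t < 2 ^ h.+1 ->
  exists m, [/\ m < h,
    exists p s, [/\ sibling t p s, exists i, good i p, exists i, good i s,
                    leaves p = 2 ^ m & leaves s = 2 ^ m.+1]
  & forall M, m <= M < h -> exists p s, [/\ sibling t p s, exists i, good i p,
      exists i, good i s &
      [&& 2 ^ M <= leaves p, leaves p < leaves s & leaves s <= 2 ^ M.+1]]].
Proof.
elim: h t => [|h IH] t; first by rewrite expn0 expn1; lia.
case: t => // a b gab lab; case/orP: (gab) => /andP[ga gb].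
- have la := perfect_leaves ga; have lb := good_leaves gb.
  have [E|N] := eqVneq (leaves b) (2 ^ h).
    exists h; split=> //.
      exists b, a; split=> //; first exact: sibling_r.
      - by exists h.
      - by exists h; apply: perfectS_good.
    move=> M HM; have -> : M = h by lia.
    exists b, a; split; first exact: sibling_r.
    - by exists h.
    - by exists h; apply: perfectS_good.
    by rewrite la E expnS; have := expn_gt0 2 h; lia.
  have [|m [mh [p [s [H1 H2 H3 H4 H5]]] HM]] := IH b gb.
    by move: lab lb N; rewrite /= la !expnS; lia.
  exists m; split; first by lia.
    by exists p, s; split=> //; apply: sibling_liftr.
  move=> M /andP[mM]; rewrite ltnS leq_eqVlt => /orP[/eqP ->|Mh].
    exists b, a; split; first exact: sibling_r.
    - by exists h.
    - by exists h; apply: perfectS_good.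
    by move: lab lb; rewrite /= la !expnS; lia.
  have [|p' [s' [? ? ? ?]]] := HM M; first by rewrite mM.
  by exists p', s'; split=> //; apply: sibling_liftr.
have la := good_leaves ga; have lb := perfect_leaves gb.
have [E|N] := eqVneq (leaves a) (2 ^ h.+1).
  exists h; split=> //.
    exists b, a; split=> //; first exact: sibling_r.
    - by exists h; apply: perfect_good.
    - by exists h.
  move=> M HM; have -> : M = h by lia.
  exists b, a; split; first exact: sibling_r.
  - by exists h; apply: perfect_good.
  - by exists h.
  by rewrite lb E expnS; have := expn_gt0 2 h; lia.
have [|m [mh [p [s [H1 H2 H3 H4 H5]]] HM]] := IH a ga.
  by move: lab la N; rewrite /= lb !expnS; lia.
exists m; split; first by lia.
  by exists p, s; split=> //; apply: sibling_liftl.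
move=> M /andP[mM]; rewrite ltnS leq_eqVlt => /orP[/eqP ->|Mh].
  exists b, a; split; first exact: sibling_r.
  - by exists h; apply: perfect_good.
  - by exists h.
  by move: lab la; rewrite /= lb !expnS; lia.
have [|p' [s' [? ? ? ?]]] := HM M; first by rewrite mM.
  by exists p', s'; split=> //; apply: sibling_liftl.
Qed.

Section BestSplit.
Variable k : nat.
Let U i := weight (best i).
Hypothesis opt : forall t, leaves t < k -> weight t <= U (leaves t).

(** Joining [best d] with a leaf gives [d.+1] leaves and weight [2 * U d + 1], so by optimality
    every extra leaf more than doubles the weight. This is the factor 2 that [sibling_swap] asks
    for. *)
Lemma best_mono c d : 0 < c -> c < d -> d < k -> 2 * U c < U d.
Proof.
move=> c0; elim: d => // d IH; rewrite ltnS => cd dk.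
have d0 : 0 < d by lia.
have [_ l] := bestP d0.
have le : (2 * U d).+1 <= U d.+1.
  have := @opt (Node Leaf (best d)); rewrite leavesN l add1n; exact.
move: cd; rewrite leq_eqVlt => /orP[/eqP -> //|cd].
by have := IH cd (ltnW dk); lia.
Qed.

Lemma weight_good h t : good h t -> weight t = U (leaves t).
Proof. by move=> /good_best {1}->. Qed.

Lemma good_weight_lt h i t u : good h t -> good i u -> leaves u < k ->
  leaves t < leaves u -> 2 * weight t < weight u.
Proof.
move=> gt gu lu tu; rewrite (weight_good gt) (weight_good gu).
exact: best_mono (leaves_gt0 t) tu lu.
Qed.

Section MaxPair.
Variables x y : btree.
Variables l : nat.
Hypotheses (gy : good l y) (Exy : leaves x + leaves y = k).
Hypothesis max_xy : forall x' y', leaves x' + leaves y' = k ->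
  weight x' * weight y' <= weight x * weight y.

(** Trading [c] with [y] turns [(wc * wd + 1) * wy] into [(wy * wd + 1) * wc], where [wc], [wd],
    [wy] are the weights: a gain of [wc - wy]. *)
Lemma max_child_le c d i : x = Node c d -> good i c -> leaves c <= leaves y.
Proof.
move=> Ex gc; rewrite leqNgt; apply/negP => lt.
have lc := leaves_gt0 c; have ld := leaves_gt0 d; have ly := leaves_gt0 y.
have Ek : leaves c + leaves (Node y d) = k by move: Exy; rewrite Ex /=; lia.
have ck : leaves c < k by move: Ek => /=; lia.
have w := good_weight_lt gy gc ck lt.
by have := max_xy Ek; rewrite Ex /=; nia.
Qed.

Lemma max_no_siblings i1 i2 i3 i4 p s q r : sibling x p s -> sibling y q r ->
  good i1 p -> good i2 s -> good i3 q -> good i4 r ->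
  leaves s < k -> leaves q < k -> leaves p < leaves q ->
  leaves r < leaves s -> False.
Proof.
move=> S1 S2 g1 g2 g3 g4 sk qk pq rs.
have w1 := good_weight_lt g1 g3 qk pq; have w2 := good_weight_lt g4 g2 sk rs.
have [||x' [y' [E lt]]] := sibling_swap S1 S2; [by lia | by lia |].
by have := @max_xy x' y'; rewrite E Exy => /(_ erefl); lia.
Qed.

(* If [x] and [y] both have an incomplete last level, they contain, at a common
   level [M], siblings of sizes between [2 ^ M] and [2 ^ M.+1]; exchanging the
   smaller one in [x] with the larger one in [y] increases the product. *)
Lemma max_no_levels z : good l z -> 2 ^ l < leaves z < 2 ^ l.+1 ->
  (forall p s, sibling z p s -> sibling x p s) ->
  2 ^ l < leaves y < 2 ^ l.+1 -> leaves z <= leaves x -> False.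
Proof.
move=> gz lz zx ly zlex.
have lx0 := leaves_gt0 x; have ly0 := leaves_gt0 y.
have [m [ml [p [s [S [i gp] [j gs] lp ls]]] HM]] := sibling_levels gz lz.
have [m' [ml' [q [r [S' [i' gq] [j' gr] lq lr]]] HM']] := sibling_levels gy ly.
have El : 2 ^ l.+1 = 2 * 2 ^ l := expnS _ _.
have lt_l M : M < l -> 2 ^ M.+1 <= 2 ^ l by move=> ?; rewrite leq_exp2l.
have [mm|mm] := leqP m m'.
  have [|p' [s' [S1 [i1 g1] [j1 g2] /and3P[c1 c2 c3]]]] := HM m'.
    by rewrite mm.
  have b1 := lt_l _ ml'.
  by apply: (max_no_siblings (zx _ _ S1) (sibling_sym S') g1 g2 gr gq); lia.
have [|q' [r' [S1 [i1 g1] [j1 g2] /and3P[c1 c2 c3]]]] := HM' m.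
  by rewrite ltnW.
have b1 := lt_l _ ml.
by apply: (max_no_siblings (zx _ _ S) (sibling_sym S1) gp gs g2 g1); lia.
Qed.
End MaxPair.

(** The bound on the children of [x] leaves at most one level between the two heights. If one of the
    trees is perfect, they can be joined; if both are incomplete, [max_no_levels] gives a
    contradiction. *)
Lemma max_pair_good x y h l : good h x -> good l y -> l <= h ->
  leaves x < 2 ^ h.+1 -> leaves y < 2 ^ l.+1 -> leaves x + leaves y = k ->
  (forall x' y', leaves x' + leaves y' = k ->
     weight x' * weight y' <= weight x * weight y) ->
  exists H, good H (Node x y) \/ good H (Node y x).
Proof.
move=> gx gy lh xh yl Exy max_xy.
have [x_lo _] := andP (good_leaves gx); have [y_lo _] := andP (good_leaves gy).
have le_exp i j : 2 ^ i < 2 ^ j -> i < j by rewrite ltn_exp2l.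
case: h gx lh xh x_lo => [|h] gx lh xh x_lo.
  exists 0; left; have l0 : l = 0 by lia.
  have E : x = Leaf by case: (x) gx xh => //= a b; case: a b => [|? ?] [|? ?] //.
  rewrite E; case: (y) gy yl; rewrite l0 // => a b.
  by case: a b => [|? ?] [|? ?].
case: x gx xh x_lo Exy max_xy => // c d gx xh x_lo Exy max_xy.
have El : 2 ^ l.+1 = 2 * 2 ^ l := expnS _ _.
have Eh : 2 ^ h.+1 = 2 * 2 ^ h := expnS _ _.
have Ehh : 2 ^ h.+2 = 2 * 2 ^ h.+1 := expnS _ _.
have cy i : good i c -> leaves c <= leaves y.
  by move=> gc; apply: (max_child_le gy Exy max_xy erefl gc).
have [px|npx] := eqVneq (leaves (Node c d)) (2 ^ h.+1).
  have pX := good_low gx px; move: (pX); rewrite perfectS => /andP[pc pd].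
  have := cy h (perfect_good pc); rewrite (perfect_leaves pc) => hy.
  have hl : h < l.+1 by apply: le_exp; lia.
  have [El1|El1] : l = h.+1 \/ l = h by lia.
    by exists h.+2; right; rewrite goodS -El1 gy El1 pX orbT.
  by exists h.+1; left; rewrite goodS pX -El1 gy.
have {}cy : leaves c <= leaves y /\
    (2 ^ h.+1 <= leaves c \/ good h c /\ 2 ^ h < leaves c).
  move: (gx); rewrite goodS => /orP[] /andP[gc gd].
    by split; [apply: (cy h); apply: perfectS_good|left; rewrite (perfect_leaves gc)].
  split; first exact: cy gc.
  right; split=> //; have /andP[] := good_leaves gc.
  by move: npx x_lo; rewrite leavesN (perfect_leaves gd); lia.
have hl : l = h.+1 \/ (l = h /\ good h c /\ 2 ^ h < leaves c).
  case: cy => cy [hc|[gc hc]].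
    by left; have : h.+1 < l.+1 by [apply: le_exp; lia]; lia.
  have : h < l.+1 by apply: le_exp; lia.
  have [->|nl] := eqVneq l h; first by right.
  by left; lia.
have [py|npy] := eqVneq (leaves y) (2 ^ l).
  case: hl => [El1|[El1 [gc hc]]]; last by move: cy; rewrite py El1; lia.
  by exists h.+2; left; rewrite goodS gx -El1 (good_low gy py) orbT.
have ly : 2 ^ l < leaves y < 2 ^ l.+1 by lia.
(* The exchange needs two trees of the same height: [y] is compared with [x] itself in the first
   case and with its child [c] in the second. *)
case: hl => [El1|[El1 [gc hc]]]; exfalso.
  apply: (max_no_levels gy Exy max_xy (z := Node c d)) => //.
    by rewrite El1.
  by rewrite El1; lia.
apply: (max_no_levels gy Exy max_xy (z := c)) => //; first by rewrite El1.
- by move: cy yl; rewrite El1; lia.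
- by move=> *; apply: sibling_liftl.
by rewrite leavesN leq_addr.
Qed.
End BestSplit.

Lemma best_opt t : weight t <= weight (best (leaves t)).
Proof.
have [n] := ubnP (leaves t); elim: n t => // n IH [|a b] //.
rewrite ltnS => ltn; set k := leaves (Node a b).
have opt t : leaves t < k -> weight t <= weight (best (leaves t)).
  by move=> tk; apply: IH; apply: leq_trans tk ltn.
pose P (i : 'I_k) := 0 < i.
pose W (i : 'I_k) := weight (best i) * weight (best (k - i)).
have la := leaves_gt0 a; have lb := leaves_gt0 b.
have ak : leaves a < k by rewrite /k /=; lia.
(* A split with the largest product among pairs of rgood shapes; by induction it is also the largest
   among all pairs of shapes. *)
have [i Pi maxi] := @arg_maxnP _ (Ordinal ak) P W la.
have [gx lx] := bestP Pi.
have ki : 0 < k - i by rewrite subn_gt0.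
have [gy ly] := bestP ki.
have E : leaves (best i) + leaves (best (k - i)) = k.
  by rewrite lx ly subnKC // ltnW.
have max_xy x' y' : leaves x' + leaves y' = k ->
    weight x' * weight y' <= weight (best i) * weight (best (k - i)).
  move=> E'; have lx' := leaves_gt0 x'; have ly' := leaves_gt0 y'.
  have xk : leaves x' < k by lia.
  apply: leq_trans (maxi (Ordinal xk) lx').
  have -> : W (Ordinal xk) = weight (best (leaves x')) * weight (best (leaves y')).
    by rewrite /W /= -E' addKn.
  by apply: leq_mul; apply: opt; lia.
have ti j : 0 < j -> j < 2 ^ (trunc_log 2 j).+1 by move=> _; apply: trunc_log_ltn.
apply: (@leq_trans (weight (best i) * weight (best (k - i))).+1).
  by rewrite /= ltnS max_xy.
have fin x y H : good H (Node x y) -> leaves x + leaves y = k ->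
    (weight x * weight y).+1 <= weight (best k).
  by move=> /good_best EN E'; rewrite -E' -[_ + _]/(leaves (Node x y)) -EN.
have [ord|ord] := leqP (trunc_log 2 (k - i)) (trunc_log 2 i).
  have [||H [g|g]] := max_pair_good opt gx gy ord _ _ E max_xy.
  - by rewrite lx ti.
  - by rewrite ly ti.
  - exact: fin g E.
  by rewrite mulnC; apply: fin g _; rewrite addnC.
have [||||H [g|g]] := max_pair_good opt gy gx (ltnW ord).
- by rewrite ly ti.
- by rewrite lx ti.
- by rewrite addnC.
- by move=> x' y'; rewrite addnC => /max_xy; rewrite mulnC [X in _ <= X]mulnC.
- by rewrite mulnC; apply: fin g _; rewrite addnC.
exact: fin g E.
Qed.

Lemma good_opt h t u : good h u -> leaves t = leaves u -> weight t <= weight u.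
Proof. by move=> /good_best {2}-> <-; apply: best_opt. Qed.

(* Subtree at vertex [v] of the binary heap in which vertex [v] has children
   [2v+1], [2v+2] and the vertices below [k] are the internal ones; [f] is fuel. *)
Fixpoint heapt f k v :=
  if f is f'.+1 then
    if v < k then Node (heapt f' k v.*2.+1) (heapt f' k v.*2.+2) else Leaf
  else Leaf.

(* The descendants of [v] that are [h] levels below it would be
   [(v+1) 2^h - 1, ..., (v+2) 2^h - 2]. *)
Lemma perfect_heapt h f k v : k - v <= f -> (v + 2) * 2 ^ h <= 2 * k + 2 ->
  k < (v + 1) * 2 ^ h -> perfect h (heapt f k v).
Proof.
elim: h f v => [|h IH] f v fk.
  by rewrite expn0 => _ kv; case: f {fk} => //= f; case: ltnP => //; lia.
rewrite expnS; have := expn_gt0 2 h => /= e0 c1 c2.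
have vk : v < k by nia.
case: f fk => [|f] fk; first by lia.
by rewrite /= vk; apply/andP; split; apply: IH; rewrite -?muln2; nia.
Qed.

Lemma good_heapt h f k v : k - v <= f -> (v + 2) * 2 ^ h <= 2 * k + 2 ->
  k < (v + 1) * 2 ^ h.+1 -> good h (heapt f k v).
Proof.
elim: h f v => [|h IH] f v fk c1 c2.
  have [kv|vk] := leqP k v; apply/orP; [left|right]; apply: perfect_heapt => //.
    by rewrite expn0; lia.
  by rewrite expn1; lia.
have e0 : 0 < 2 ^ h by rewrite expn_gt0.
move: c1 c2; rewrite !expnS => c1 c2.
have vk : v < k by nia.
case: f fk => [|f] fk; first by lia.
rewrite [heapt _ _ _]/= vk goodS.
have [le|gt] := leqP ((2 * v + 3) * 2 ^ h.+1) (2 * k + 2).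
  apply/orP; left; apply/andP; split; [apply: perfect_heapt|apply: IH];
    move: le; rewrite ?expnS -?muln2; nia.
apply/orP; right; apply/andP; split; [apply: IH|apply: perfect_heapt];
  move: gt; rewrite ?expnS -?muln2; nia.
Qed.

Lemma good_heap k : exists h, good h (heapt k k 0).
Proof.
exists (trunc_log 2 k.+1).
have /andP[lo hi] := trunc_log_bounds (isT : 1 < 2) (isT : 0 < k.+1).
by apply: good_heapt; rewrite ?subn0 ?add0n ?mul1n //; lia.
Qed.

(** * Distances and branches in trees *)

Section Dist.
Variable G : sgraph.
Implicit Types x y z : G.

Lemma walkP x y k :
  reflect (exists p, [/\ size p = k, path (@adj G) x p & last x p = y])
          (walk_of_length x y k).
Proof.
apply: (iffP existsP) => [[p /andP[pp /eqP lp]]|[p [sp pp lp]]].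
  by exists p; rewrite size_tuple.
by exists (Tuple (introT eqP sp)); rewrite /= pp lp eqxx.
Qed.

Lemma dist_le_size x p : path (@adj G) x p -> dist x (last x p) <= size p.
Proof.
move=> pp; rewrite leqNgt; apply/negP => lt.
have lt' : size p < #|G|.
  by apply: leq_trans lt _; rewrite -[X in _ <= X](size_iota 0) find_size.
have := before_find 0 lt; rewrite nth_iota // add0n => /negbT/negP[].
by apply/walkP; exists p.
Qed.

Lemma dist_xx x : dist x x = 0.
Proof. by apply/eqP; rewrite -leqn0 (@dist_le_size x [::]). Qed.

Hypothesis conn : forall x y, connect (@adj G) x y.

Lemma dist_has x y : has (walk_of_length x y) (iota 0 #|G|).
Proof.
have /connectP[p0 /shortenP[p pp up _] ->] := conn x y.
apply/hasP; exists (size p); last by apply/walkP; exists p.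
by rewrite mem_iota add0n -[(size p).+1]/(size (x :: p)) -(card_uniqP up) max_card.
Qed.

Lemma dist_lt_card x y : dist x y < #|G|.
Proof. by have := dist_has x y; rewrite has_find size_iota. Qed.

Lemma shortest_path x y :
  exists p, [/\ size p = dist x y, path (@adj G) x p & last x p = y].
Proof.
apply/walkP; have := nth_find 0 (dist_has x y).
by rewrite nth_iota ?add0n // dist_lt_card.
Qed.

Lemma dist_eq0 x y : (dist x y == 0) = (x == y).
Proof.
apply/eqP/eqP => [E|->]; last exact: dist_xx.
by have [[|z p] [+ _ <-]] := shortest_path x y; rewrite E.
Qed.

Lemma dist_sym x y : dist x y = dist y x.
Proof.
suff le (u v : G) : dist u v <= dist v u by apply/eqP; rewrite eqn_leq !le.
have [p [<- pp <-]] := shortest_path v u.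
have := @dist_le_size (last v p) (rev (belast v p)).
rewrite rev_path size_rev size_belast.
have -> : last (last v p) (rev (belast v p)) = v.
  by case: (p) => //= z s; rewrite rev_cons last_rcons.
apply; rewrite (eq_path (e' := @adj G)) // => a b; exact: adj_sym.
Qed.

Lemma dist_triangle y x z : dist x z <= dist x y + dist y z.
Proof.
have [p [<- pp <-]] := shortest_path x y.
have [q [<- qq <-]] := shortest_path (last x p) z.
by rewrite -size_cat -last_cat; apply: dist_le_size; rewrite cat_path pp.
Qed.

Lemma adj_dist x y : adj x y -> dist x y = 1.
Proof.
move=> xy; have := @dist_le_size x [:: y]; rewrite /= xy => /(_ isT) le.
have : dist x y != 0 by rewrite dist_eq0; apply: contraTneq xy => ->; rewrite adj_irr.
lia.
Qed.

Lemma dist_adj_le x y z : adj x y -> dist x z <= (dist y z).+1.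
Proof. by move=> xy; have := dist_triangle y x z; rewrite (adj_dist xy). Qed.

Lemma closer_neighbor x y : x != y -> exists2 z, adj x z & dist x y = (dist z y).+1.
Proof.
move=> xy; have [[|z p] [sp /= pp lp]] := shortest_path x y.
  by move: xy; rewrite -lp eqxx.
have /andP[xz zp] := pp; exists z => //.
have := dist_adj_le y xz; have := dist_le_size zp; rewrite lp; move: sp => /=; lia.
Qed.
End Dist.

Section Tree.
Variable G : sgraph.
Hypothesis tG : is_tree G.
Implicit Types (p q u v x y a b : G) (X : {set G}).

Let conn : forall x y, connect (@adj G) x y. Proof. by case: tG. Qed.

(** Shortest paths to [u] from such neighbours cannot pass through [p], so two distinct ones would
    be joined off [p] and close a cycle with it. The inequalities are weak so that [adj_dist_cases]
    can exclude a neighbour at equal distance. *)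
Lemma tree_closer_unique p q q' u : adj p q -> adj p q' ->
  dist q u <= dist p u -> dist q' u <= dist p u -> q = q'.
Proof.
move=> pq pq' le le'; apply/eqP/negPn/negP => ne.
have [_ _ acyc] := tG.
pose e x y := [&& adj x y, x != p & y != p].
have e_sym : symmetric e.
  by move=> x y; rewrite /e adj_sym; congr (_ && _); rewrite andbC.
have to_u r : adj p r -> dist r u <= dist p u -> connect e r u.
  move=> pr ler; have [w [sw rw lw]] := shortest_path conn r u.
  have rp : r != p by apply: contraTneq pr => ->; rewrite adj_irr.
  have pw : p \notin w.
    apply/negP => /splitPr H; case: H sw rw lw => w1 w2.
    rewrite size_cat cat_path last_cat /= => sw /and3P[_ _ w2p] lw.
    by have := dist_le_size w2p; rewrite lw; lia.
  apply/connectP; exists w => //; move: rw pw rp {lw sw ler pr}.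
  elim: w r => //= z w IH r /andP[rz zw]; rewrite inE negb_or eq_sym => /andP[zp pw] rp.
  by rewrite {1}/e rz rp zp IH.
have qq' : connect e q q'.
  apply: connect_trans (to_u _ pq le) _.
  by rewrite (sym_connect_sym e_sym) to_u.
have /connectP[w0 /shortenP[w qw uw _] lw] := qq'.
apply: (acyc (p :: q :: w)).
  by case: w lw {qw uw} => //= E; move: ne; rewrite E eqxx.
have sub : forall r, r != p -> path e r w -> path (@adj G) r w /\ p \notin r :: w.
  elim: (w) => [|z s IH] r rp /=; first by rewrite inE eq_sym.
  case/andP=> /and3P[rz _ zp] /(IH _ zp) [zs ps].
  by rewrite rz zs inE negb_or eq_sym rp.
have qp : q != p by apply: contraTneq pq => ->; rewrite adj_irr.
have [qw' pqw] := sub q qp qw.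
apply/andP; split; last by rewrite cons_uniq pqw.
by rewrite /= pq rcons_path qw' -lw adj_sym pq'.
Qed.

Lemma adj_dist_cases p q u : adj p q ->
  dist p u = (dist q u).+1 \/ dist q u = (dist p u).+1.
Proof.
move=> pq; have qp : adj q p by rewrite adj_sym.
have l1 := dist_adj_le conn u pq; have l2 := dist_adj_le conn u qp.
have [E|] := eqVneq (dist p u) (dist q u); last by lia.
have [pu|pu] := eqVneq p u.
  move: E; rewrite pu dist_xx => /esym/eqP; rewrite dist_eq0 // => /eqP qu.
  by move: pq; rewrite pu qu adj_irr.
have [z pz Ez] := closer_neighbor conn pu.
have zq : z = q by apply: (@tree_closer_unique p z q u); lia.
by rewrite zq in Ez; lia.
Qed.

(** For an edge [pq] of a tree, the component of [q] after deleting that edge, described by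
    distances so that no second graph is needed. *)
Definition branch p q := [set v | dist v q < dist v p].

Lemma in_branch p q v : adj p q -> (v \in branch p q) = (dist v p == (dist v q).+1).
Proof.
move=> pq; rewrite inE; have := adj_dist_cases v pq.
by rewrite ![dist v _]dist_sym //; lia.
Qed.

Lemma branchC p q : adj p q -> branch q p = ~: branch p q.
Proof.
move=> pq; apply/setP => v; rewrite !inE; have := adj_dist_cases v pq.
by rewrite ![dist v _]dist_sym //; lia.
Qed.

Lemma branch_root p q : adj p q -> q \in branch p q.
Proof. by move=> pq; rewrite inE dist_xx adj_dist // adj_sym. Qed.

Lemma branch_sub p q a : adj p q -> adj q a -> a != p -> branch q a \subset branch p q.
Proof.
move=> pq qa ap; apply/subsetP => v.
rewrite (in_branch _ pq) (in_branch _ qa) => /eqP E.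
have qp : adj q p by rewrite adj_sym.
have := adj_dist_cases v pq; rewrite !(dist_sym conn _ v) => -[->//|E2].
case/eqP: ap; apply: (@tree_closer_unique q a p v) => //.
  by rewrite !(dist_sym conn _ v); lia.
by rewrite !(dist_sym conn _ v); lia.
Qed.

Lemma branch_child p q v : adj p q -> v \in branch p q -> v != q ->
  exists a, [/\ adj q a, a != p & v \in branch q a].
Proof.
move=> pq vb; rewrite eq_sym => vq; have [a qa E] := closer_neighbor conn vq.
exists a; split=> //; last first.
  by rewrite in_branch // !(dist_sym conn v) E.
by apply: contraTneq vb => ap; rewrite in_branch // !(dist_sym conn v) -ap E; lia.
Qed.

Lemma branch_disjoint q a b : adj q a -> adj q b -> a != b ->
  [disjoint branch q a & branch q b].
Proof.
move=> qa qb ab; apply/pred0P => v /=; apply/negP => /andP[].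
rewrite !in_branch // => /eqP E1 /eqP E2; case/eqP: ab.
by apply: (@tree_closer_unique q a b v) => //; rewrite !(dist_sym conn _ v); lia.
Qed.

(** A crossing edge satisfies [dist x q = dist y p]. Were [y] not [p], its neighbour [z] towards [p]
    would, like [x], be closer to [q] than [y] is; then [z = x], although [x] is farther from [p]
    than [y]. *)
Lemma branch_edge p q x y : adj p q -> adj x y ->
  x \in branch p q -> y \notin branch p q -> x = q /\ y = p.
Proof.
move=> pq xy; rewrite !in_branch // => /eqP Ex ney.
have qp : adj q p by rewrite adj_sym.
have Ey : dist y q = (dist y p).+1.
  by have := adj_dist_cases y pq; rewrite !(dist_sym conn _ y); move/eqP: ney; lia.
have l1 := dist_adj_le conn p xy.
have yx : adj y x by rewrite adj_sym.
have l2 := dist_adj_le conn q yx.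
have Exy : dist x q = dist y p by lia.
have [yp|yp] := eqVneq y p.
  by split=> //; apply/eqP; rewrite -(dist_eq0 conn) Exy yp dist_xx.
have [z yz Ez] := closer_neighbor conn yp.
have zx : z = x.
  apply: (@tree_closer_unique y z x q) => //; last by lia.
  by have := dist_triangle conn p z q; rewrite (adj_dist conn pq); lia.
by rewrite zx in Ez; lia.
Qed.

(** The edge is moved one step at a time towards [x], while [y] stays on the side left behind. *)
Lemma dist_across p q x y : adj p q -> x \in branch p q -> y \in branch q p ->
  dist x y = dist x q + 1 + dist p y.
Proof.
move=> + + yb; have [n] := ubnP (dist x q); elim: n p q yb => // n IH p q yb lt pq xb.
have qp : adj q p by rewrite adj_sym.
have qy : dist q y = (dist p y).+1.
  by move: yb; rewrite in_branch // !(dist_sym conn y) => /eqP.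
have [->|xq] := eqVneq x q; first by rewrite dist_xx qy; lia.
have [a [qa ap xa]] := branch_child pq xb xq.
have aq : adj a q by rewrite adj_sym.
have Ea : dist x q = (dist x a).+1 by move: xa; rewrite in_branch // => /eqP.
have ya : y \in branch a q by apply: subsetP yb; apply: branch_sub; rewrite // eq_sym.
by rewrite (IH q a) //; lia.
Qed.
End Tree.

(** * Counting subtrees *)

Section Count.
Variable G : sgraph.
Hypothesis tG : is_tree G.
Implicit Types (p q u v x y a b : G) (W X : {set G}).

Let conn : forall x y, connect (@adj G) x y. Proof. by case: tG. Qed.

(* In a tree, a vertex set containing [q] induces a connected subgraph iff it is
   closed under moving one step towards [q]. *)
Definition closed_towards q W :=
  (q \in W) && [forall x in W, forall y, adj x y ==> (dist y q < dist x q) ==> (y \in W)].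

Lemma closed_towardsP q W : reflect (q \in W /\
  forall x y, x \in W -> adj x y -> dist y q < dist x q -> y \in W) (closed_towards q W).
Proof.
apply: (iffP andP) => -[qW H]; split=> //.
  move=> x y xW xy yx.
  by have := forallP (implyP (forallP H x) xW) y; rewrite xy yx.
apply/forallP => x; apply/implyP => xW; apply/forallP => y.
by apply/implyP => xy; apply/implyP => yx; apply: H xW xy yx.
Qed.

Lemma closed_towards_branch p q x y : adj p q -> x \in branch p q ->
  adj x y -> x != q -> y \in branch p q /\ (dist y q < dist x q) = (dist y p < dist x p).
Proof.
move=> pq xb xy xq; have yb : y \in branch p q.
  apply/negPn/negP => nyb; have [E _] := branch_edge tG pq xy xb nyb.
  by rewrite E eqxx in xq.
by split=> //; move: xb yb; rewrite !(in_branch tG) // => /eqP -> /eqP ->.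
Qed.

Definition count_towards q X := #|[set W : {set G} | (W \subset X) && closed_towards q W]|.

Lemma count_towards1 q : count_towards q [set q] = 1.
Proof.
rewrite /count_towards (_ : [set W | _] = [set [set q]]) ?cards1 //.
apply/setP => W; rewrite !inE; apply/andP/eqP => [[sW /closed_towardsP[qW _]]|->].
  by apply/eqP; rewrite eqEsubset sW sub1set.
split=> //; apply/closed_towardsP; split; first exact: set11.
by move=> x y /set1P-> _; rewrite (dist_xx q).
Qed.

(** A set closed towards [q] splits into its part in [X] and its part in the branch. The latter is
    closed towards [a] or empty, whence the extra unit. *)
Lemma count_towardsU q a X : adj q a -> [disjoint X & branch q a] ->
  count_towards q (X :|: branch q a) =
  count_towards q X * (count_towards a (branch q a)).+1.
Proof.
move=> qa dX; have aq : adj a q by rewrite adj_sym.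
set A := [set W : {set G} | (W \subset X) && closed_towards q W].
set B := [set W : {set G} | (W \subset branch q a) && closed_towards a W].
have qB : q \notin branch q a by rewrite inE dist_xx.
have XB x : x \in X -> x \notin branch q a by move=> xX; rewrite (disjointFr dX xX).
have -> : (count_towards a (branch q a)).+1 = #|set0 |: B|.
  by rewrite cardsU1 !inE sub0set /= /closed_towards inE add1n.
rewrite /count_towards -/A -cardsX.
pose f (WW : {set G} * {set G}) := WW.1 :|: WW.2.
have sub2 W2 : W2 \in set0 |: B -> W2 \subset branch q a.
  by rewrite !inE => /orP[/eqP->|/andP[]]; first exact: sub0set.
have split1 W1 W2 : W1 \subset X -> W2 \subset branch q a ->
    (W1 :|: W2) :&: X = W1 /\ (W1 :|: W2) :&: branch q a = W2.
  move=> s1 s2; rewrite !setIUl (setIidPl s1) (setIidPl s2); split.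
    suff /disjoint_setI0-> : [disjoint W2 & X] by rewrite setU0.
    by rewrite disjoint_sym; apply: disjointWr s2 dX.
  suff /disjoint_setI0-> : [disjoint W1 & branch q a] by rewrite set0U.
  exact: disjointWl s1 dX.
rewrite -(@card_in_imset _ _ f (setX A (set0 |: B))); last first.
  move=> [W1 W2] [W1' W2'] /setXP[W1A W2B] /setXP[W1A' W2B'].
  move: W1A W1A' (sub2 _ W2B) (sub2 _ W2B') => /=.
  rewrite !inE => /andP[s1 _] /andP[s1' _] s2 s2' E.
  have [E1 E2] := split1 _ _ s1 s2; have [E1' E2'] := split1 _ _ s1' s2'.
  by move: E; rewrite /f /= => E; congr (_, _); [rewrite -E1 E E1'|rewrite -E2 E E2'].
congr #|pred_of_set _|; apply/setP => W; rewrite inE.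
apply/andP/imsetP => [[sW /closed_towardsP[qW cW]]|].
  (* A closed set that meets the branch contains [a]: inside the branch, a step towards [q] is a
     step towards [a]. *)
  have step x : x \in W -> x \in branch q a -> a \in W.
    have [n] := ubnP (dist x a); elim: n x => // n IH x lt xW xb.
    have [<-//|xa] := eqVneq x a.
    have [y xy E] := closer_neighbor conn xa.
    have [yb Ey] := closed_towards_branch qa xb xy xa.
    apply: (IH y) => //; first by lia.
    by apply: cW xW xy _; rewrite -Ey; lia.
  exists (W :&: X, W :&: branch q a); last first.
    by rewrite /f /= -setIUr; apply/esym/setIidPl.
  apply/setXP; split; rewrite /= !inE subsetIr /=.
    apply/closed_towardsP; split.
      by rewrite inE qW; have := subsetP sW q qW; rewrite inE (negPf qB) orbF.
    move=> x y /setIP[xW xX] xy lt; have yW := cW x y xW xy lt.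
    rewrite inE yW; have := subsetP sW y yW; rewrite inE => /orP[//|yb].
    have yx : adj y x by rewrite adj_sym.
    have [_ xq] := branch_edge tG qa yx yb (XB _ xX).
    by move: lt; rewrite xq dist_xx.
  have [//|[x /setIP[xW xb]]] := set_0Vmem (W :&: branch q a).
    by move=> ->; rewrite eqxx.
  apply/orP; right; apply/closed_towardsP; split.
    by rewrite inE (step x xW xb) branch_root.
  move=> y z /setIP[yW yb] yz lt.
  have ya : y != a by apply: contraTneq lt => ->; rewrite dist_xx.
  have [zb Ez] := closed_towards_branch qa yb yz ya.
  by rewrite inE zb andbT; apply: cW yW yz _; rewrite -Ez.
move=> [[W1 W2] /setXP[/= W1A W2B] ->]; rewrite /f /=.
have s2 := sub2 _ W2B; move: W1A; rewrite inE => /andP[s1 /closed_towardsP[qW c1]].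
split; first exact: setUSS.
apply/closed_towardsP; split; first by rewrite inE qW.
move=> x y; rewrite !inE => /orP[xW|xW] xy lt; first by rewrite (c1 x y).
have xb := subsetP s2 x xW.
move: W2B; rewrite in_setU1 => /orP[/eqP W0|]; first by rewrite W0 inE in xW.
rewrite inE => /andP[_ /closed_towardsP[aW c2]].
have [xa|xa] := eqVneq x a.
  suff -> : y = q by rewrite qW.
  apply: (@tree_closer_unique _ tG a y q q) => //; first by rewrite -xa.
    by rewrite -xa ltnW.
  by rewrite dist_xx.
have [yb Ey] := closed_towards_branch qa xb xy xa.
by rewrite (c2 x y) ?orbT // Ey.
Qed.

Lemma edgesE u v : ([set u; v] \in edges G) = adj u v.
Proof.
apply/imsetP/idP => [[[a b]]|uv]; last by exists (u, v); rewrite ?inE.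
rewrite inE /= => ab E.
have := set21 a b; have := set22 a b; rewrite -E => /set2P Eb /set2P Ea.
by case: Ea Eb ab => -> [] ->; rewrite ?adj_irr // adj_sym.
Qed.

Lemma connect_exit (e : rel G) X x y : connect e x y -> x \in X -> y \notin X ->
  exists u v, [/\ e u v, u \in X & v \notin X].
Proof.
move=> /connectP[s + ->]; elim: s x => [|z s IH] x /=; first by move=> _ ->.
move=> /andP[xz zs] xX; have [zX|zX] := boolP (z \in X); first exact: IH.
by exists x, z.
Qed.

Definition induced W := (W, [set e in edges G | e \subset W]).

(** A connection from [x] to [q] in [H] has to leave [branch y x], and [xy] is the only edge that
    does. Hence the vertices of a subtree determine its edges, and vertex sets can be counted
    instead. *)
Lemma subtree_edge (H : {set G} * {set {set G}}) q x y : is_subtree H ->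
  q \in H.1 -> x \in H.1 -> adj x y -> dist y q < dist x q -> [set x; y] \in H.2.
Proof.
move=> /and3P[/andP[sE _] _ cH] qH xH xy lt.
have yx : adj y x by rewrite adj_sym.
have c : connect (fun a b => [set a; b] \in H.2) x q.
  by have := implyP (forallP (implyP (forallP cH x) xH) q) qH.
have [||u [v [uv ub vb]]] := connect_exit c (X := branch y x).
- exact: branch_root.
- by rewrite inE -leqNgt !(dist_sym conn q) ltnW.
have auv : adj u v by rewrite -edgesE (subsetP sE).
by have [<- <-] := branch_edge tG yx auv ub vb.
Qed.

Lemma subtree_induced H q : is_subtree H -> q \in H.1 ->
  H = induced H.1 /\ closed_towards q H.1.
Proof.
move=> sH qH; have edge := subtree_edge sH qH.
have /and3P[/andP[sE /forallP sV] _ _] := sH.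
split; last first.
  apply/closed_towardsP; split=> // x y xH xy lt.
  have := implyP (sV [set x; y]) (edge x y xH xy lt).
  by move=> /subsetP; apply; rewrite set22.
rewrite {1}[H]surjective_pairing /induced; congr (_, _); apply/setP => e.
rewrite inE; apply/idP/andP => [eH|[]].
  by rewrite (subsetP sE) // (implyP (sV e)).
case/imsetP=> -[a b]; rewrite inE /= => ab -> /subsetP sab.
have aH : a \in H.1 by apply: sab; rewrite set21.
have bH : b \in H.1 by apply: sab; rewrite set22.
have [E|E] := adj_dist_cases tG q ab; first by apply: edge; rewrite // E.
by rewrite setUC; apply: edge; rewrite // ?E // adj_sym.
Qed.

Lemma closed_subtree q W : closed_towards q W -> is_subtree (induced W).
Proof.
move=> /closed_towardsP[qW cW]; apply/and3P; split.
- apply/andP; split; first by apply/subsetP => e; rewrite inE => /andP[].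
  by apply/forallP => e; apply/implyP; rewrite inE => /andP[].
- by apply/set0Pn; exists q.
pose e : rel G := fun a b => [set a; b] \in (induced W).2.
have e_sym : symmetric e by move=> a b; rewrite /e setUC.
have to_q x : x \in W -> connect e x q.
  have [n] := ubnP (dist x q); elim: n x => // n IH x lt xW.
  have [-> //|xq] := eqVneq x q.
  have [y xy E] := closer_neighbor conn xq.
  have yW : y \in W by apply: cW xW xy _; rewrite E.
  apply: connect_trans (IH y _ yW); last by lia.
  apply: connect1; rewrite /e inE edgesE xy.
  by apply/subsetP => z /set2P[]->.
apply/forallP => x; apply/implyP => xW; apply/forallP => y; apply/implyP => yW.
by apply: connect_trans (to_q x xW) _; rewrite (sym_connect_sym e_sym) to_q.
Qed.

Lemma num_subtreesE q : num_subtrees q = count_towards q [set: G].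
Proof.
rewrite /num_subtrees /count_towards.
set A := [set H | _]; have injA : {in A &, injective (fun H => H.1)}.
  move=> H K; rewrite !inE => /andP[sH qH] /andP[sK qK] E.
  have [-> _] := subtree_induced sH qH; have [-> _] := subtree_induced sK qK.
  by rewrite E.
rewrite -(card_in_imset injA); congr #|pred_of_set _|; apply/setP => W.
rewrite inE subsetT /=; apply/imsetP/idP => [[H]|cW].
  by rewrite inE => /andP[sH qH] ->; have [] := subtree_induced sH qH.
exists (induced W) => //; rewrite inE (closed_subtree cW) /=.
by case/closed_towardsP: cW.
Qed.

Lemma num_subtrees_edge p q : adj p q -> num_subtrees q =
  count_towards q (branch p q) * (count_towards p (branch q p)).+1.
Proof.
move=> pq; have qp : adj q p by rewrite adj_sym.
rewrite num_subtreesE -count_towardsU //.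
  by rewrite (branchC tG pq) setUCr.
by rewrite (branchC tG pq) -setI_eq0 setICr.
Qed.
End Count.

(** * Branch shapes, center and core *)

(* The component of [q] left after deleting the edge [pq], rooted at [q], has
   shape [t]. *)
Fixpoint branch_shape (G : sgraph) (p q : G) (t : btree) : Prop :=
  adj p q /\
  match t with
  | Leaf => forall x, adj q x = (x == p)
  | Node t1 t2 => exists a b,
      [/\ uniq [:: p; a; b], forall x, adj q x = (x \in [:: p; a; b]),
          branch_shape q a t1 & branch_shape q b t2]
  end.

Section Shape.
Variable G : sgraph.
Hypothesis tG : is_tree G.
Implicit Types (p q u v x y a b : G) (X : {set G}).

Let conn : forall x y, connect (@adj G) x y. Proof. by case: tG. Qed.

Lemma shape_adj p q t : branch_shape p q t -> adj p q.
Proof. by case: t => [|? ?] []. Qed.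

Lemma shape_node p q t1 t2 : branch_shape p q (Node t1 t2) -> exists a b,
  [/\ [/\ adj p q, adj q a & adj q b], [/\ a != p, b != p & a != b],
      forall x, adj q x = (x \in [:: p; a; b]),
      branch_shape q a t1 & branch_shape q b t2].
Proof.
case=> pq [a [b [un H s1 s2]]]; exists a, b; split=> //.
  by rewrite !H !inE !eqxx !orbT.
move: un; rewrite /= !inE negb_or (eq_sym p a) (eq_sym p b) andbT.
by case/andP=> /andP[-> ->] ->.
Qed.

Lemma branch_leaf p q : branch_shape p q Leaf -> branch p q = [set q].
Proof.
case=> pq H; apply/setP => v; rewrite in_set1; apply/idP/eqP => [vb|->].
  have [//|vq] := eqVneq v q.
  have [a [qa ap _]] := branch_child tG pq vb vq.
  by move: qa; rewrite H (negPf ap).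
exact: branch_root.
Qed.

Lemma branch_node p q a b : adj p q -> a != p -> b != p ->
  (forall x, adj q x = (x \in [:: p; a; b])) ->
  branch p q = q |: (branch q a :|: branch q b).
Proof.
move=> pq ap bp H; apply/setP => v; rewrite in_setU1 in_setU.
have qa : adj q a by rewrite H !inE eqxx !orbT.
have qb : adj q b by rewrite H !inE eqxx !orbT.
apply/idP/or3P => [vb|].
  have [->|vq] := eqVneq v q; first by constructor 1.
  have [c [qc cp vc]] := branch_child tG pq vb vq.
  move: qc vc; rewrite H !inE (negPf cp) /= => /orP[]/eqP-> vc.
    by constructor 2.
  by constructor 3.
case=> [/eqP->|va|vb]; first exact: branch_root.
  exact: subsetP (branch_sub tG pq qa ap) v va.
exact: subsetP (branch_sub tG pq qb bp) v vb.
Qed.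

Lemma notin_branch p q : p \notin branch p q.
Proof. by rewrite inE dist_xx. Qed.

Lemma shape_card p q t : branch_shape p q t -> #|branch p q|.+1 = 2 * leaves t.
Proof.
elim: t p q => [|t1 IH1 t2 IH2] p q s; first by rewrite (branch_leaf s) cards1.
have [a [b [[pq qa qb] [ap bp ab] H s1 s2]]] := shape_node s.
rewrite (branch_node pq ap bp H) cardsU1 in_setU !(negPf (notin_branch q _)) /=.
rewrite cardsU (_ : _ :&: _ = set0) ?cards0; last first.
  by apply/eqP; rewrite setI_eq0 branch_disjoint.
by move: (IH1 _ _ s1) (IH2 _ _ s2); lia.
Qed.

Lemma shape_count p q t : branch_shape p q t ->
  (count_towards q (branch p q)).+1 = weight t.
Proof.
elim: t p q => [|t1 IH1 t2 IH2] p q s.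
  by rewrite (branch_leaf s) count_towards1.
have [a [b [[pq qa qb] [ap bp ab] H s1 s2]]] := shape_node s.
rewrite (branch_node pq ap bp H) setUA !count_towardsU //.
- by rewrite (IH1 _ _ s1) (IH2 _ _ s2) count_towards1 mul1n.
- by rewrite -setI_eq0; apply/eqP/setP => x; rewrite !inE;
     case: eqP => // ->; rewrite dist_xx.
rewrite -setI_eq0 setIUl setU_eq0 !setI_eq0 branch_disjoint // andbT.
by rewrite -setI_eq0; apply/eqP/setP => x; rewrite !inE;
     case: eqP => // ->; rewrite dist_xx.
Qed.

Lemma shape_depth_le p q t v : branch_shape p q t -> v \in branch p q ->
  dist v q <= depth t.
Proof.
elim: t p q => [|t1 IH1 t2 IH2] p q s.
  by rewrite (branch_leaf s) => /set1P->; rewrite dist_xx.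
have [a [b [[pq qa qb] [ap bp ab] H s1 s2]]] := shape_node s.
rewrite (branch_node pq ap bp H) !in_setU1 in_setU => /or3P[/eqP->|va|vb].
- by rewrite dist_xx.
- have := IH1 _ _ s1 va; move: va; rewrite in_branch // => /eqP-> /=; lia.
have := IH2 _ _ s2 vb; move: vb; rewrite in_branch // => /eqP-> /=; lia.
Qed.

Lemma shape_depth p q t : branch_shape p q t ->
  exists2 v, v \in branch p q & dist v q = depth t.
Proof.
elim: t p q => [|t1 IH1 t2 IH2] p q s.
  by exists q; rewrite ?(branch_leaf s) ?set11 ?dist_xx.
have [a [b [[pq qa qb] [ap bp ab] H s1 s2]]] := shape_node s.
have [v va Ev] := IH1 _ _ s1; have [w wb Ew] := IH2 _ _ s2.
have [le|lt] := leqP (depth t2) (depth t1).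
  exists v; first exact: subsetP (branch_sub tG pq qa ap) v va.
  by move: va; rewrite in_branch // => /eqP -> /=; lia.
exists w; first exact: subsetP (branch_sub tG pq qb bp) w wb.
by move: wb; rewrite in_branch // => /eqP -> /=; lia.
Qed.

Lemma ecc_geq u v : dist u v <= ecc v.
Proof. exact: leq_bigmax. Qed.

Lemma ecc_leq v m : (forall u, dist u v <= m) -> ecc v <= m.
Proof. by move=> H; apply/bigmax_leqP. Qed.

Lemma ecc_shape p q t t' : branch_shape p q t -> branch_shape q p t' ->
  ecc q = maxn (depth t) (depth t').+1.
Proof.
move=> s s'; have pq := shape_adj s; have qp := shape_adj s'.
have [v vb Ev] := shape_depth s; have [w wb Ew] := shape_depth s'.
apply/eqP; rewrite eqn_leq; apply/andP; split.
  apply: ecc_leq => u; have [ub|] := boolP (u \in branch p q).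
    by have := shape_depth_le s ub; lia.
  rewrite -in_setC -branchC // => ub; have := shape_depth_le s' ub.
  by move: ub; rewrite in_branch // => /eqP ->; lia.
have := ecc_geq v q; have := ecc_geq w q.
by move: wb; rewrite in_branch // => /eqP ->; lia.
Qed.

Lemma num_subtrees_shape p q t t' : branch_shape p q t -> branch_shape q p t' ->
  num_subtrees q = (weight t).-1 * weight t'.
Proof.
move=> s s'; rewrite (num_subtrees_edge tG (shape_adj s)).
by rewrite -(shape_count s) -(shape_count s').
Qed.

(** Moves the viewpoint from the edge [pq] to an edge below [q]: the sibling branch joins the side
    left behind. *)
Lemma shape_shift p q t1 t2 t' : branch_shape p q (Node t1 t2) -> branch_shape q p t' ->
  exists a b, [/\ a != p, b != p, branch p q = q |: (branch q a :|: branch q b),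
    branch_shape q a t1 /\ branch_shape a q (Node t2 t') &
    branch_shape q b t2 /\ branch_shape b q (Node t1 t')].
Proof.
move=> s s'; have [a [b [[pq qa qb] [ap bp ab] H s1 s2]]] := shape_node s.
exists a, b; split=> //; first exact: branch_node.
  split=> //; split; first by rewrite adj_sym.
  exists b, p; split=> //; last by move=> x; rewrite H !inE orbC orbA.
  by rewrite /= !inE negb_or ab ap bp.
split=> //; split; first by rewrite adj_sym.
exists a, p; split=> //; last by move=> x; rewrite H !inE orbC -!orbA orbCA.
by rewrite /= !inE negb_or eq_sym ab ap bp.
Qed.

(* If crossing an edge towards the side of larger [W] is an improvement, then
   the whole other side is worse: [W] only grows when walking away from it. *)
Lemma shape_worse (R : rel G) (W : btree -> nat) : transitive R ->
  (forall t1 t2, W t1 < W (Node t1 t2) /\ W t2 < W (Node t1 t2)) ->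
  (forall p q t t', branch_shape p q t -> branch_shape q p t' ->
     W t < W t' -> R q p) ->
  forall p q t t', branch_shape p q t -> branch_shape q p t' -> W t < W t' ->
  forall x, x \in branch p q -> R x p.
Proof.
move=> Rtr WN Redge p q t; elim: t p q => [|t1 IH1 t2 IH2] p q t' s s' lt x.
  by rewrite (branch_leaf s) => /set1P ->; apply: Redge s s' lt.
have Rqp := Redge _ _ _ _ s s' lt.
have [a [b [_ _ -> [s1 s1'] [s2 s2']]]] := shape_shift s s'.
have [w1 w2] := WN t1 t2; have [w3 w4] := WN t2 t'; have [w5 w6] := WN t1 t'.
rewrite in_setU1 in_setU => /or3P[/eqP->//|xa|xb].
  by apply: Rtr Rqp; apply: (IH1 _ _ _ s1 s1') => //; lia.
by apply: Rtr Rqp; apply: (IH2 _ _ _ s2 s2') => //; lia.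
Qed.

Lemma core_subset p q t t' : branch_shape p q t -> branch_shape q p t' ->
  weight t < weight t' -> subtree_core G \subset branch q p.
Proof.
move=> s s' lt; apply/subsetP => x; rewrite (branchC tG (shape_adj s)) inE.
rewrite inE => /forallP /(_ p) le; apply: contraL le => xb; rewrite -ltnNge.
move: x xb; apply: (@shape_worse (fun x y => num_subtrees x < num_subtrees y) weight) s s' lt.
- by move=> a b c; apply: ltn_trans.
- by move=> t1 t2 /=; have := weight_ge2 t1; have := weight_ge2 t2; nia.
move=> {}p {}q {}t {}t' s s' lt; rewrite (num_subtrees_shape s s') (num_subtrees_shape s' s).
by have := weight_ge2 t; nia.
Qed.

Lemma center_subset p q t t' : branch_shape p q t -> branch_shape q p t' ->
  depth t < depth t' -> center G \subset branch q p.
Proof.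
move=> s s' lt; apply/subsetP => x; rewrite (branchC tG (shape_adj s)) inE.
rewrite inE => /forallP /(_ p) le; apply: contraL le => xb; rewrite -ltnNge.
move: x xb; apply: (@shape_worse (fun x y => ecc y < ecc x) depth) s s' lt.
- by move=> a b c ba cb; apply: ltn_trans cb ba.
- by move=> t1 t2 /=; lia.
move=> {}p {}q {}t {}t' s s' lt; rewrite (ecc_shape s s') (ecc_shape s' s); lia.
Qed.

Lemma dist_set_le X (Y : {set G}) x y : x \in X -> y \in Y -> dist_set X Y <= dist x y.
Proof.
have min_le (I : finType) (P : pred I) (F : I -> nat) n i : P i ->
    \big[minn/n]_(j | P j) F j <= F i.
  move=> Pi; have := mem_index_enum i.
  elim: (index_enum I) => //= j r IH; rewrite inE big_cons => /orP[/eqP<-|/IH le].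
    by rewrite Pi geq_minl.
  by case: ifP => // _; apply: leq_trans (geq_minr _ _) le.
move=> xX yY; apply: leq_trans (min_le _ _ _ _ _ xX) _; exact: (min_le _ _ _ _ _ yY).
Qed.

Lemma leq_dist_set X (Y : {set G}) m : m <= #|G| ->
  (forall x y, x \in X -> y \in Y -> m <= dist x y) -> m <= dist_set X Y.
Proof.
move=> mG H; rewrite /dist_set; elim/big_ind: _ => // [a b|x xX].
  by rewrite leq_min => -> ->.
elim/big_ind: _ => // [a b|y yY]; last exact: H.
by rewrite leq_min => -> ->.
Qed.

Lemma center_neq0 : exists x, x \in center G.
Proof.
have /card_gt0P[x0 _] : 0 < #|G| by case: tG.
case: (@arg_minnP _ x0 xpredT (@ecc G) isT) => x _ min.
by exists x; rewrite inE; apply/forallP => u; apply: min.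
Qed.

Lemma core_neq0 : exists x, x \in subtree_core G.
Proof.
have /card_gt0P[x0 _] : 0 < #|G| by case: tG.
case: (@arg_maxnP _ x0 xpredT (@num_subtrees G) isT) => x _ max.
by exists x; rewrite inE; apply/forallP => u; apply: max.
Qed.

(** Each step along the spine shortens the comb ahead by one and deepens the part behind by one, a
    leg adding nothing to the depth. The last clause records how far the walk has come. *)
Lemma comb_walk p q m t i : branch_shape p q (comb m) -> branch_shape q p t -> i <= m ->
  exists u v t', [/\ branch_shape u v (comb (m - i)), branch_shape v u t',
    depth t' = depth t + i &
    forall x y, x \in branch u v -> y \in branch q p -> i < dist x y].
Proof.
move=> s s'; elim: i => [|i IH] im.
  exists p, q, t; rewrite subn0 addn0; split=> // x y xb yb.
  by rewrite (dist_across tG (shape_adj s)) //; lia.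
have [u [v [t' [su sv Et H]]]] := IH (ltnW im).
have E : m - i = (m - i.+1).+1 by lia.
rewrite E in su; have [_ [a [_ au _ _ [sa sa']]]] := shape_shift su sv.
exists v, a, (Node Leaf t'); split=> //=; first by rewrite max0n Et addnS.
have va := shape_adj sa; have uv := shape_adj su.
have sub := branch_sub tG uv va au.
move=> x y xa yb; have vb := branch_root tG uv.
have yv : y \in branch a v.
  rewrite branchC // inE; apply/negP => ya.
  have := H y y; rewrite dist_xx => /(_ (subsetP sub y ya) yb); lia.
by rewrite (dist_across tG va) //; have := H v y vb yb; lia.
Qed.

Lemma leq_center_core_dist p q m t D : 0 < D ->
  branch_shape p q (comb m) -> branch_shape q p t ->
  weight (comb m) < weight t -> depth t + 2 * D <= m.+1 ->
  D <= center_core_dist G.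
Proof.
move=> D0 s s' lt mD; have core := core_subset s s' lt.
(* After [D.-1] steps the depths are [depth t + D.-1] behind and [m - D.-1] ahead; [mD] makes the
   latter larger, so the center lies still ahead. *)
have [|u [v [t' [su sv Et H]]]] := comb_walk (i := D.-1) s s'; first by lia.
have cen : center G \subset branch u v.
  by apply: center_subset sv su _; rewrite depth_comb Et; lia.
have le x y : x \in center G -> y \in subtree_core G -> D <= dist x y.
  by move=> /(subsetP cen) xb /(subsetP core) yb; have := H x y xb yb; lia.
apply: leq_dist_set => //; have [x xc] := center_neq0; have [y yc] := core_neq0.
by apply: leq_trans (le x y xc yc) _; rewrite ltnW // dist_lt_card.
Qed.
End Shape.

(** * From a binary tree to the two sides of an edge at the core *)

Section Binary.
Variable G : sgraph.
Hypothesis bG : binary_tree G.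
Implicit Types (p q u v x y a b : G).

Let tG : is_tree G. Proof. by case: bG. Qed.
Let conn : forall x y, connect (@adj G) x y. Proof. by case: tG. Qed.

Lemma shape_exists p q : adj p q -> exists t, branch_shape p q t.
Proof.
have [n] := ubnP #|branch p q|; elim: n p q => // n IH p q lt pq.
have qp : adj q p by rewrite adj_sym.
have [_ deg] := bG; have := deg q.
have [/cards1P[x Ex] _|_ /(_ isT) d3] := boolP (pendant q).
  exists Leaf; split=> // y; move/setP: Ex => Ex.
  have := Ex y; have := Ex p; rewrite !inE qp => /esym/eqP->; exact.
have : #|[set u | adj q u] :\ p| == 2.
  by move: d3; rewrite /degree (cardsD1 p) inE qp add1n => -[->].
move=> /cards2P[a [b [ab Eab]]].
have H x : adj q x = (x \in [:: p; a; b]).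
  have /setP/(_ x) := Eab; rewrite !inE.
  by case: (eqVneq x p) => [->|_] //=; rewrite qp.
have nb c : c \in [set a; b] -> adj q c /\ c != p.
  by rewrite -Eab !inE => /andP[-> ->].
have [qa ap] := nb a (set21 a b); have [qb bp] := nb b (set22 a b).
have less c : adj q c -> c != p -> #|branch q c| < n.
  move: lt; rewrite ltnS => lt qc cp; apply: leq_trans lt; apply: proper_card; apply/properP.
  split; first exact: branch_sub.
  by exists q; [apply: branch_root | apply: notin_branch].
have [t1 s1] := IH _ _ (less a qa ap) qa.
have [t2 s2] := IH _ _ (less b qb bp) qb.
exists (Node t1 t2); split=> //; exists a, b; split=> //.
by rewrite /= !inE negb_or ab eq_sym ap eq_sym bp.
Qed.

Lemma center_core_shape : 0 < center_core_dist G -> exists t t',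
  [/\ (leaves t + leaves t').*2 = #|G|.+2, weight t < weight t'
    & depth t' + 2 * center_core_dist G <= (depth t).+1].
Proof.
move=> D0.
have [c0 cc0] := center_neq0 tG; have [s0 sc0] := core_neq0 tG.
pose P (z : G * G) := (z.1 \in center G) && (z.2 \in subtree_core G).
have P0 : P (c0, s0) by rewrite /P cc0.
case: (@arg_minnP _ (c0, s0) P (fun z => dist z.1 z.2) P0) => -[c s] /andP[/= cc sc] min.
have {}min c' s' : c' \in center G -> s' \in subtree_core G -> dist c s <= dist c' s'.
  by move=> h1 h2; apply: (min (c', s')); rewrite /P h1.
have Dle : center_core_dist G <= dist c s by apply: dist_set_le.
have cs : c != s by rewrite -(dist_eq0 conn); lia.
have sc' : s != c by rewrite eq_sym.
have [z cz Ez] := closer_neighbor conn cs.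
have [v sv Ev] := closer_neighbor conn sc'.
have zc : adj z c by rewrite adj_sym.
have vs : adj v s by rewrite adj_sym.
rewrite (dist_sym conn s c) (dist_sym conn v c) in Ev.
have [t St] := shape_exists sv; have [t' St'] := shape_exists vs.
exists t, t'; split.
- have := shape_card tG St; have := shape_card tG St'.
  by rewrite (branchC tG sv) -(cardsC (branch s v)); clear; lia.
- have nv : v \notin subtree_core G by apply/negP => vc; have := min c v cc vc; rewrite Ev ltnn.
  have : num_subtrees v < num_subtrees s.
    rewrite ltnNge; apply: contra nv => le; rewrite inE; apply/forallP => u.
    by move: sc; rewrite inE => /forallP/(_ u) le'; apply: leq_trans le' le.
  rewrite (num_subtrees_shape tG St St') (num_subtrees_shape tG St' St).
  by case: (weight t) (weight t') => [|a] [|b] //; clear; rewrite /= !mulnS; lia.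
have nz : z \notin center G by apply/negP => zC; have := min z s zC sc; rewrite Ez ltnn.
have ecz : ecc c < ecc z.
  rewrite ltnNge; apply: contra nz => le; rewrite inE; apply/forallP => u.
  by move: cc; rewrite inE => /forallP/(_ u); apply: leq_trans.
(* A vertex [u] farthest from [z] lies behind [c], and [dist u c >= ecc c >= dist c s + depth t'].
   From [v] it is [dist c s - 1] farther away, so [depth t >= depth t' + 2 * dist c s - 1]. *)
have [u Eu] : exists u, ecc z = dist u z.
  have G0 : 0 < #|G| by case: tG.
  by have [u Eu] := eq_bigmax (fun u => dist u z) G0; exists u.
have ub : u \in branch z c.
  by rewrite inE -Eu; apply: leq_ltn_trans ecz; apply: ecc_geq.
have Euc : dist u z = (dist u c).+1 by apply/eqP; rewrite -in_branch.
have sb : s \in branch c z by rewrite in_branch // !(dist_sym conn s) Ez.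
have Eus := dist_across tG zc ub sb.
have tri := dist_triangle conn c u v.
have ubv : u \in branch s v.
  by rewrite inE Eus; move: tri Ev Ez; clear; lia.
have d1 := shape_depth_le tG St ubv.
have [w wb Ew] := shape_depth tG St'.
have cb : c \in branch s v by rewrite inE Ev.
have := dist_across tG sv cb wb; have := ecc_geq w c.
have tri2 := dist_triangle conn v u s; rewrite (adj_dist conn vs) in tri2.
rewrite (dist_sym conn s w) Ew (dist_sym conn c w).
rewrite Eus in tri2.
move: Ev Ez ecz Euc Dle tri2 d1; rewrite Eu; clear; lia.
Qed.
End Binary.

(** * Trees given by a parent function *)

(** A certificate from which acyclicity and distances to the root follow once and for all; it is
    supplied for the heap, the caterpillar and their gluing. *)
Definition parent_structure (G : sgraph) (r : G) (par : G -> G) (dep : G -> nat) :=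
  [/\ dep r = 0,
      forall v, v != r -> adj v (par v) /\ dep v = (dep (par v)).+1
    & forall u v, adj u v -> (u != r /\ par u = v) \/ (v != r /\ par v = u)].

Section Parent.
Variables (G : sgraph) (r : G) (par : G -> G) (dep : G -> nat).
Hypothesis PS : parent_structure r par dep.

Lemma parent_connect x y : connect (@adj G) x y.
Proof.
have [_ up _] := PS; have sc := sym_connect_sym (@adj_sym G).
have to_r v : connect (@adj G) v r.
  have [n] := ubnP (dep v); elim: n v => // n IH v lt.
  have [->//|vr] := eqVneq v r; have [a d] := up v vr.
  by apply: connect_trans (connect1 a) (IH _ _); lia.
by apply: connect_trans (to_r x) _; rewrite sc.
Qed.

(* Both neighbours, on a cycle, of a deepest vertex would be its parent. *)
Lemma parent_is_tree : is_tree G.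
Proof.
have [_ up down] := PS; split; first by apply/card_gt0P; exists r.
  exact: parent_connect.
move=> c c2 uc.
have [x0 x0c] : exists x, x \in c by case: (c) c2 => // x s _; exists x; rewrite inE eqxx.
have [x xc max] := @arg_maxnP _ x0 (mem c) dep x0c.
have [i s Es] := rot_to xc.
have us : ucycle (@adj G) (x :: s) by rewrite -Es rot_ucycle.
have sz : 1 < size s by move: c2; rewrite -(size_rot i) Es.
have max_s y : y \in s -> dep y <= dep x.
  by move=> ys; apply: max; rewrite -[mem c y]/(y \in c) -(mem_rot i) Es inE ys orbT.
case: s Es us sz max_s => // y s _; case/lastP: s => // s z /andP[cyc un] _ max_s.
move: cyc un; rewrite /= rcons_path last_rcons => /andP[xy /andP[_ zx]].
rewrite rcons_uniq mem_rcons inE => /and3P[_ + _]; rewrite negb_or => /andP[yz _].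
have is_par w : adj x w -> w \in y :: rcons s z -> par x = w.
  move=> xw ws; case: (down _ _ xw) => [[_ ->//]|[wr Ew]].
  by have [_] := up w wr; rewrite Ew; have := max_s w ws; lia.
have Ey : par x = y by apply: is_par; rewrite ?inE ?eqxx.
have Ez : par x = z by apply: is_par; rewrite ?inE ?mem_rcons ?inE ?eqxx ?orbT // adj_sym.
by rewrite -Ey Ez eqxx in yz.
Qed.

Lemma parent_dist v : dist r v = dep v.
Proof.
have [r0 up down] := PS; apply/eqP; rewrite eqn_leq; apply/andP; split.
  rewrite (dist_sym parent_connect).
  have [n] := ubnP (dep v); elim: n v => // n IH v lt.
  have [->|vr] := eqVneq v r; first by rewrite dist_xx.
  have [a d] := up v vr; apply: leq_trans (dist_adj_le parent_connect _ a) _.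
  by rewrite d ltnS; apply: IH; lia.
have [p [<- pp <-]] := shortest_path parent_connect r v.
have {r0} : dep r <= 0 by rewrite r0.
rewrite -[X in _ -> _ <= X]add0n; move: 0 pp.
elim: p (r : G) => [|y p IH] x n; first by rewrite addn0.
rewrite /= addnS -addSn => /andP[xy yp] le; apply: IH => //.
case: (down _ _ xy) => -[ne E]; have [_] := up _ ne; rewrite E; lia.
Qed.
End Parent.

Lemma degree_seq (G : sgraph) (v : G) (s : seq G) :
  (forall x, adj v x = (x \in s)) -> uniq s -> degree v = size s.
Proof.
move=> H us; rewrite /degree -(card_uniqP us); apply: eq_card => x.
by rewrite inE H.
Qed.

Section GlueTree.
Variables (G : sgraph) (r : G) (par : G -> G) (dep : G -> nat).
Variables (H : sgraph) (k : H) (par' : H -> H) (dep' : H -> nat).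
Hypotheses (PS : parent_structure r par dep) (PS' : parent_structure k par' dep').

Let S := glue r k.
Let gpar (a : S) : S := match a with
  | inl u => inl (par u)
  | inr z => if insub (par' (val z)) is Some z' then inr z' else inl r
  end.
Let gdep (a : S) : nat := match a with inl u => dep u | inr z => dep' (val z) end.

Lemma glue_parent : parent_structure (inl r : S) gpar gdep.
Proof.
have [r0 up down] := PS; have [k0 up' down'] := PS'; split=> //.
  move=> [u|[z zk]] /=; first exact: up.
  move=> _; have [a d] := up' z zk; case: insubP => [w _ Ew|] /=.
    by rewrite Ew.
  by rewrite negbK => /eqP Ek; rewrite Ek in a d; rewrite eqxx r0 d k0.
move=> [u|z] [v|w] /=.
- by move=> /down[] [ne <-]; [left|right].
- move=> /andP[/eqP-> kw]; right; split=> //.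
  have wk := valP w; case: (down' _ _ kw) => -[+ E]; first by rewrite eqxx.
  by rewrite E insubF ?eqxx.
- move=> /andP[/eqP-> kw]; left; split=> //.
  have wk := valP z; case: (down' _ _ kw) => -[+ E]; last by rewrite eqxx.
  by rewrite E insubF ?eqxx.
move=> zw; case: (down' _ _ zw) => -[ne E]; [left|right]; split=> //; rewrite E.
  by rewrite valK.
by rewrite valK.
Qed.

Lemma glue_is_tree : is_tree S.
Proof. exact: parent_is_tree glue_parent. Qed.
End GlueTree.

(** * Rgood trees as binary heaps *)

Section Heap.
Variable k : nat.

Definition heap_adj (u v : 'I_k.*2.+1) : bool :=
  [|| v == u.*2.+1 :> nat, v == u.*2.+2 :> nat,
      u == v.*2.+1 :> nat | u == v.*2.+2 :> nat].

Lemma heap_adj_sym : symmetric heap_adj.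
Proof. move=> u v; rewrite /heap_adj; lia. Qed.

Lemma heap_adj_irr : irreflexive heap_adj.
Proof. move=> u; rewrite /heap_adj; lia. Qed.

Definition heap := SGraph heap_adj_sym heap_adj_irr.

Definition hv (v : nat) : heap := inord v.

Lemma hvK v : v <= k.*2 -> hv v = v :> nat.
Proof. exact: inordK. Qed.

Lemma heap_le (v : heap) : v <= k.*2.
Proof. by rewrite -ltnS. Qed.

Lemma eq_hv (x : heap) v : v <= k.*2 -> (x == hv v) = (x == v :> nat).
Proof. by move=> vk; rewrite -val_eqE /= hvK. Qed.

Definition heap_level (v : heap) := trunc_log 2 v.+1.

Lemma heap_level_child (v w : heap) : w = v.*2.+1 :> nat \/ w = v.*2.+2 :> nat ->
  heap_level w = (heap_level v).+1.
Proof.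
rewrite /heap_level => E; rewrite trunc_log2S; last by lia.
by congr (trunc_log 2 _).+1; lia.
Qed.

Lemma heap_parent :
  parent_structure (hv 0) (fun v => hv v.-1./2) heap_level.
Proof.
split=> [|v|u v].
- by rewrite /heap_level hvK.
- have := heap_le v; rewrite eq_hv // => vk v0; split.
    by rewrite /= /heap_adj hvK; lia.
  by apply: heap_level_child; rewrite hvK; lia.
rewrite /= /heap_adj => a; have := heap_le u; have := heap_le v => hu hw.
have [uv|vu] : (u < v) \/ (v < u) by lia.
  right; split; first by rewrite eq_hv; lia.
  by apply/eqP; rewrite eq_sym eq_hv; lia.
left; split; first by rewrite eq_hv; lia.
by apply/eqP; rewrite eq_sym eq_hv; lia.
Qed.

Lemma heap_height (v : heap) : height (hv 0) v = heap_level v.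
Proof. exact: parent_dist heap_parent v. Qed.

Lemma heap_adj_internal (v x : heap) : 0 < v < k ->
  adj v x = (x \in [:: hv v.-1./2; hv v.*2.+1; hv v.*2.+2]).
Proof.
move=> vk; rewrite !inE !eq_hv /= /heap_adj; try lia.
Qed.

Lemma heap_adj_leaf (v x : heap) : 0 < v -> k <= v -> adj v x = (x \in [:: hv v.-1./2]).
Proof.
move=> v0 vk; have hx := heap_le x; have hy := heap_le v.
by rewrite !inE !eq_hv /= /heap_adj; lia.
Qed.

Lemma heap_adj_root (x : heap) : 0 < k -> adj (hv 0) x = (x \in [:: hv 1; hv 2]).
Proof. by move=> k0; have hx := heap_le x; rewrite !inE !eq_hv /= /heap_adj ?hvK; lia. Qed.

Hypothesis k_gt0 : 0 < k.

Lemma heap_degree (v : heap) :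
  degree v = if v == 0 :> nat then 2 else if v < k then 3 else 1.
Proof.
case: (eqVneq (v : nat) 0) => [v0|v0].
  have -> : v = hv 0 by apply/eqP; rewrite eq_hv // v0.
  rewrite (degree_seq (s := [:: hv 1; hv 2])) // => [x|]; first exact: heap_adj_root.
  by rewrite /= inE eq_hv ?hvK; lia.
case: (ltnP v k) => vk.
  rewrite (degree_seq (s := [:: hv v.-1./2; hv v.*2.+1; hv v.*2.+2])) // => [x|].
    by apply: heap_adj_internal; lia.
  by rewrite /= !inE !eq_hv ?hvK; lia.
by rewrite (degree_seq (s := [:: hv v.-1./2])) // => x; apply: heap_adj_leaf; lia.
Qed.

Lemma heap_pendant (v : heap) : pendant v = (k <= v).
Proof.
rewrite /pendant heap_degree; case: (eqVneq (v : nat) 0) => [->|_].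
  by rewrite leqNgt k_gt0.
by case: ltnP.
Qed.

Lemma heap_top_level : top_level (hv 0) = trunc_log 2 k.*2.+1.
Proof.
apply/eqP; rewrite eqn_leq; apply/andP; split.
  by apply/bigmax_leqP => v _; rewrite heap_height leq_trunc_log // ltnS heap_le.
apply: leq_trans (@leq_bigmax _ (fun v => height (hv 0) v) (hv k.*2)).
by rewrite heap_height /heap_level hvK.
Qed.

Lemma heap_is_parent (u v : heap) : is_parent (hv 0) u v ->
  v = u.*2.+1 :> nat \/ v = u.*2.+2 :> nat.
Proof.
rewrite /is_parent !heap_height /= /heap_adj => /andP[a /eqP l].
have [uv|vu] := leqP u v; first by lia.
have : heap_level v <= heap_level u by apply: leq_trunc_log; lia.
lia.
Qed.

Lemma heap_rgood : rgood (hv 0).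
Proof.
split.
- split; first exact: parent_is_tree heap_parent.
  right; split; first by rewrite heap_degree hvK.
  by move=> v; rewrite heap_degree eq_hv // => /negPf->; case: ltnP; auto.
- move=> u v; rewrite !heap_pendant !heap_height /heap_level => uk vk.
  have := heap_le u; rewrite -trunc_log2_double // => u2.
  by apply: leq_trunc_log; lia.
(* A heap fills its last level from the left while [rgood] asks for a final segment, so the order of
   the indices is reversed. *)
exists (fun u v : heap => v <= u).
  split=> [l l0|l u v pu pv l0 _ _ /heap_is_parent up /heap_is_parent vp].
    split=> [u _|u v _ _|u v w _ _ _|u v _ _] //=.
    - by rewrite -eqn_leq => /eqP E; apply: val_inj.
    - by move=> uv vw; apply: leq_trans vw uv.
    by rewrite orbC; apply: leq_total.
  by rewrite -val_eqE /= => ne; lia.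
move=> u v; rewrite !heap_height => hu hw /existsP[w /and3P[_ _ /heap_is_parent wu]] vu.
have wk := heap_le w; have vk : v.*2.+1 <= k.*2 by lia.
have E : heap_level (hv v.*2.+1) = (heap_level v).+1.
  by apply: heap_level_child; rewrite hvK; auto.
apply/existsP; exists (hv v.*2.+1); apply/and3P; split.
- rewrite heap_pendant hvK // leqNgt; apply/negP => lt.
  have : heap_level (hv v.*2.+1.*2.+1) = (heap_level (hv v.*2.+1)).+1.
    by apply: heap_level_child; rewrite !hvK; lia.
  rewrite E hw heap_top_level => lev.
  have : heap_level (hv v.*2.+1.*2.+1) <= trunc_log 2 k.*2.+1.
    by apply: leq_trunc_log; rewrite ltnS heap_le.
  by rewrite lev ltnn.
- by rewrite heap_height E hw.
rewrite /is_parent !heap_height E eqxx andbT /= /heap_adj hvK //.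
by rewrite eqxx.
Qed.
End Heap.

(** * Caterpillars and gluing *)

(** The spine is [0, 1, 3, 5, ...] and the legs are [2, 4, ...]: both [2i+2] and [2i+3] hang from
    [2i+1], and [1] hangs from [0]. *)
Definition cat_par v := (v./2).*2.-1.

Section CatShape.
Variables (G : sgraph) (f : nat -> G) (m : nat).
Hypothesis f_inj : {in [pred v | v < m.*2.+2] &, injective f}.
Hypothesis adj01 : adj (f 0) (f 1).
Hypothesis adj_spine : forall i x, i < m ->
  adj (f i.*2.+1) x = (x \in [:: f (cat_par i.*2.+1); f i.*2.+2; f i.*2.+3]).
Hypothesis adj_end : forall x, adj (f m.*2.+1) x = (x \in [:: f (cat_par m.*2.+1)]).
Hypothesis adj_leg : forall i x, i < m ->
  adj (f i.*2.+2) x = (x \in [:: f (cat_par i.*2.+2)]).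

(** Stated for an embedding [f] so that it serves the caterpillar both alone and inside the glued
    tree. There [f 0] has further neighbours, so only its edge to [f 1] is prescribed. *)
Lemma comb_shape i j : i + j = m ->
  branch_shape (f (cat_par i.*2.+1)) (f i.*2.+1) (comb j).
Proof.
have adj_par i' : i' <= m -> adj (f (cat_par i'.*2.+1)) (f i'.*2.+1).
  case: i' => [|i'] im; first exact: adj01.
  have -> : cat_par i'.+1.*2.+1 = i'.*2.+1 by rewrite /cat_par; lia.
  by rewrite adj_spine // !inE doubleS eqxx !orbT.
elim: j i => [|j IH] i E.
  split; first by apply: adj_par; lia.
  by move=> x; have -> : i = m by [lia]; rewrite adj_end inE.
have im : i < m by lia.
split; first by apply: adj_par; lia.
exists (f i.*2.+2), (f i.*2.+3); split.
- rewrite /= !inE !(inj_in_eq f_inj) ?inE /cat_par; lia.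
- by move=> x; apply: adj_spine.
- have Ep : cat_par i.*2.+2 = i.*2.+1 by rewrite /cat_par; lia.
  split; first by rewrite adj_spine // !inE eqxx orbT.
  by move=> x; rewrite adj_leg // inE Ep.
have := IH i.+1; rewrite doubleS.
have -> : cat_par i.*2.+3 = i.*2.+1 by rewrite /cat_par; lia.
by apply; lia.
Qed.
End CatShape.

Section HeapShape.
Variables (G : sgraph) (p : G) (f : nat -> G) (k : nat).
Hypothesis f_inj : {in [pred v | v <= k.*2] &, injective f}.
Hypothesis pf : forall v, v <= k.*2 -> p != f v.
Hypothesis k_gt0 : 0 < k.
Hypothesis adj_p : adj p (f 0).
Hypothesis adj_root : forall x, adj (f 0) x = (x \in [:: p; f 1; f 2]).
Hypothesis adj_internal : forall v x, 0 < v < k ->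
  adj (f v) x = (x \in [:: f v.-1./2; f v.*2.+1; f v.*2.+2]).
Hypothesis adj_leaf : forall v x, 0 < v -> k <= v <= k.*2 ->
  adj (f v) x = (x \in [:: f v.-1./2]).

(** The vertex [p], through which the heap hangs in a larger tree, acts as the parent of the heap
    root. *)
Lemma heap_shape n v : k - v <= n -> v <= k.*2 ->
  branch_shape (if v == 0 then p else f v.-1./2) (f v) (heapt n k v).
Proof.
set pv := fun v : nat => if v == 0 then p else f v.-1./2.
have adj_v u x : u < k -> adj (f u) x = (x \in [:: pv u; f u.*2.+1; f u.*2.+2]).
  by rewrite /pv; case: u => [|u] uk; [apply: adj_root | apply: adj_internal].
have adj_pv u : u <= k.*2 -> adj (pv u) (f u).
  rewrite /pv; case: (eqVneq u 0) => [->//|u0] uk.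
  have [ku|uk'] := leqP k u; rewrite adj_sym.
    by rewrite adj_leaf ?inE ?eqxx //; lia.
  by rewrite adj_internal ?inE ?eqxx //; lia.
rewrite -/(pv v); elim: n v => [|n IH] v vn vk.
  split; first exact: adj_pv.
  move=> x; rewrite adj_leaf ?inE /pv; [|lia|lia].
  by case: (eqVneq v 0) => //; lia.
rewrite [heapt _ _ _]/=; case: ltnP => kv; last first.
  split; first exact: adj_pv.
  move=> x; rewrite adj_leaf ?inE /pv; [|lia|lia].
  by case: (eqVneq v 0) => //; lia.
split; first exact: adj_pv.
exists (f v.*2.+1), (f v.*2.+2); split.
- rewrite /= !inE (inj_in_eq f_inj) ?inE; try lia.
  rewrite /pv; case: (eqVneq v 0) => [->|v0].
    by rewrite !(negPf (pf _)) //=; lia.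
  by rewrite !(inj_in_eq f_inj) ?inE; lia.
- by move=> x; apply: adj_v.
- have := IH v.*2.+1; rewrite {1}/pv /= doubleK; apply; lia.
have := IH v.*2.+2; rewrite {1}/pv /= uphalf_double; apply; lia.
Qed.
End HeapShape.

Section Glue.
Variables (G : sgraph) (r : G) (H : sgraph) (k : H).
Let S := glue r k.

Definition glue_r (w : H) : S := if insub w is Some z then inr z else inl r.

Lemma glue_rE (z : {z : H | z != k}) : glue_r (val z) = inr z.
Proof. by rewrite /glue_r valK. Qed.

Lemma glue_r_root : glue_r k = inl r.
Proof. by rewrite /glue_r insubF ?eqxx. Qed.

Lemma glue_r_inj : injective glue_r.
Proof.
move=> v w; rewrite /glue_r.
case: insubP => [z _ <-|/negbNE/eqP->]; case: insubP => [z' _ <-|/negbNE/eqP->] //.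
by case=> ->.
Qed.

Lemma glue_adj_l (v : G) s : v != r -> (forall u, adj v u = (u \in s)) ->
  forall x : S, adj (inl v : S) x = (x \in map inl s).
Proof.
move=> vr Hs [u|w]; first by rewrite mem_map -?Hs // => a b [].
rewrite /= (negPf vr); apply/esym/negP => /mapP[u _ //].
Qed.

Lemma glue_adj_r (v : H) s : v != k -> (forall u, adj v u = (u \in s)) ->
  forall x : S, adj (glue_r v) x = (x \in map glue_r s).
Proof.
move=> vk Hs x; rewrite -[v]/(val (Sub v vk : {z : H | z != k})) glue_rE.
case: x => [u|w] /=.
  have [->|ur] := eqVneq u r; first by rewrite -glue_r_root (mem_map glue_r_inj) -Hs.
  apply/esym/negP => /mapP[w _]; rewrite /glue_r; case: insubP => // _ [E].
  by rewrite E eqxx in ur.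
by rewrite -glue_rE (mem_map glue_r_inj) -Hs.
Qed.

Lemma glue_adj_root s w : (forall u, adj r u = (u \in s)) ->
  (forall u, adj k u = (u \in [:: w])) ->
  forall x : S, adj (inl r : S) x = (x \in glue_r w :: map inl s).
Proof.
move=> Hr Hk; have kw : w != k.
  by apply/eqP => E; have := Hk w; rewrite inE eqxx E adj_irr.
move=> [u|z] /=.
  rewrite inE mem_map -?Hr => [|a b [] //].
  by rewrite -[w]/(val (Sub w kw : {z : H | z != k})) glue_rE.
rewrite eqxx Hk !inE -glue_rE (inj_eq glue_r_inj).
rewrite (_ : (_ \in map _ _) = false) ?orbF //.
by apply/negP => /mapP[u _]; rewrite glue_rE.
Qed.
End Glue.

(** Apart from [q], a pair of vertices either contains the leg [a], at most one farther from
    everything than [q], or lies in the shorter comb. The bound shows that the end [0] of the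
    caterpillar has maximum eccentricity, as gluing requires. *)
Lemma comb_diam (G : sgraph) (tG : is_tree G) (p q : G) m :
  branch_shape p q (comb m) ->
  forall x y, x \in branch p q -> y \in branch p q -> dist x y <= m.+1.
Proof.
have [_ conn _] := tG.
elim: m p q => [|m IH] p q s x y.
  by rewrite (branch_leaf tG s) => /set1P-> /set1P->; rewrite dist_xx.
have [a [b [[pq qa qb] [ap bp ab] H s1 s2]]] := shape_node s.
have Ea := branch_leaf tG s1.
have dq z : z \in branch p q -> dist z q <= m.+1.
  by move=> zb; rewrite (leq_trans (shape_depth_le tG s zb)) // depth_comb.
have aq : adj a q by rewrite adj_sym.
have near z : z \in branch p q -> dist a z <= m.+2.
  by move=> zb; apply: leq_trans (dist_adj_le conn z aq) _; rewrite ltnS dist_sym ?dq.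
have [->|xq] := eqVneq x q; first by move=> _ /dq; rewrite dist_sym //; lia.
have [->|yq] := eqVneq y q; first by move=> /dq; lia.
have Eb := branch_node tG pq ap bp H.
move=> xb yb; move: (xb) (yb); rewrite Eb Ea !inE (negPf xq) (negPf yq) /=.
move=> /orP[/eqP->|xb'] /orP[/eqP->|yb']; rewrite ?dist_xx ?near //.
  by rewrite dist_sym // near.
by apply/ltnW; apply: (IH q b s2); rewrite inE.
Qed.

(** * The concrete caterpillar *)

Section Caterpillar.
Variable m : nat.

Definition cat_adj (u v : 'I_m.*2.+2) : bool :=
  (0 < v) && (u == cat_par v :> nat) || (0 < u) && (v == cat_par u :> nat).

Lemma cat_adj_sym : symmetric cat_adj.
Proof. by move=> u v; rewrite /cat_adj orbC. Qed.

Lemma cat_adj_irr : irreflexive cat_adj.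
Proof. move=> u; rewrite /cat_adj /cat_par; lia. Qed.

Definition caterpillar := SGraph cat_adj_sym cat_adj_irr.

Definition cv (v : nat) : caterpillar := inord v.

Lemma cvK v : v <= m.*2.+1 -> cv v = v :> nat.
Proof. exact: inordK. Qed.

Lemma caterpillar_le (v : caterpillar) : v <= m.*2.+1.
Proof. by rewrite -ltnS. Qed.

Lemma eq_cv (x : caterpillar) v : v <= m.*2.+1 -> (x == cv v) = (x == v :> nat).
Proof. by move=> vm; rewrite -val_eqE /= cvK. Qed.

Lemma cat_par_le v : cat_par v <= v.
Proof. rewrite /cat_par; lia. Qed.

Lemma cv_inj : {in [pred v | v < m.*2.+2] &, injective cv}.
Proof. by move=> u v; rewrite !inE => um vm /(congr1 val) /=; rewrite !cvK. Qed.

Lemma caterpillar_parent : parent_structure (cv 0) (fun v => cv (cat_par v))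
  (fun v => if v == 0 :> nat then 0 else v./2.+1).
Proof.
have ub (v : caterpillar) : cat_par v <= m.*2.+1.
  exact: leq_trans (cat_par_le v) (caterpillar_le v).
split=> [|v|u v]; first by rewrite cvK.
  rewrite eq_cv // => v0; split.
    by move: v0; rewrite -lt0n /= /cat_adj cvK // => ->; rewrite eqxx orbT.
  by rewrite cvK // (negPf v0) /cat_par; case: eqVneq; lia.
rewrite /= /cat_adj => /orP[]/andP[p0 /eqP E]; [right|left].
  by rewrite eq_cv // -lt0n; split=> //; apply/eqP; rewrite eq_sym eq_cv // E.
by rewrite eq_cv // -lt0n; split=> //; apply/eqP; rewrite eq_sym eq_cv // E.
Qed.

Lemma caterpillar_is_tree : is_tree caterpillar.
Proof. exact: parent_is_tree caterpillar_parent. Qed.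

Lemma caterpillar_adj0 x : adj (cv 0) x = (x \in [:: cv 1]).
Proof.
have hx := caterpillar_le x.
by rewrite !inE !eq_cv //= /cat_adj /cat_par cvK //; lia.
Qed.

Lemma caterpillar_adj_spine i x : i < m ->
  adj (cv i.*2.+1) x = (x \in [:: cv (cat_par i.*2.+1); cv i.*2.+2; cv i.*2.+3]).
Proof.
move=> im; have hx := caterpillar_le x.
by rewrite !inE !eq_cv /= /cat_adj ?cvK /cat_par; lia.
Qed.

Lemma caterpillar_adj_end x : adj (cv m.*2.+1) x = (x \in [:: cv (cat_par m.*2.+1)]).
Proof.
have hx := caterpillar_le x.
by rewrite !inE !eq_cv /= /cat_adj ?cvK /cat_par; lia.
Qed.

Lemma caterpillar_adj_leg i x : i < m ->
  adj (cv i.*2.+2) x = (x \in [:: cv (cat_par i.*2.+2)]).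
Proof.
move=> im; have hx := caterpillar_le x.
by rewrite !inE !eq_cv /= /cat_adj ?cvK /cat_par; lia.
Qed.

Lemma caterpillar_cases (v : caterpillar) :
  [\/ v = cv 0, exists2 i, i < m & v = cv i.*2.+1, v = cv m.*2.+1
    | exists2 i, i < m & v = cv i.*2.+2].
Proof.
have hv := caterpillar_le v; have Ev : v = cv v by apply/eqP; rewrite eq_cv.
have [v0|v0] := eqVneq (v : nat) 0; first by constructor 1; rewrite Ev v0.
have [vm|vm] := eqVneq (v : nat) m.*2.+1; first by constructor 3; rewrite Ev vm.
have [od|ev] := boolP (odd v).
  by constructor 2; exists v./2; [lia | rewrite {1}Ev; congr cv; lia].
by constructor 4; exists v./2.-1; [lia | rewrite {1}Ev; congr cv; lia].
Qed.

Lemma caterpillar_binary : binary_tree caterpillar.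
Proof.
split; first exact: caterpillar_is_tree.
move=> v; rewrite /pendant; case: (caterpillar_cases v) => [->|[i im ->]|->|[i im ->]].
- by rewrite (degree_seq caterpillar_adj0).
- rewrite (degree_seq (fun x => caterpillar_adj_spine x im)) //.
  by rewrite /= !inE !(inj_in_eq cv_inj) ?inE /cat_par; lia.
- by rewrite (degree_seq caterpillar_adj_end).
by rewrite (degree_seq (fun x => caterpillar_adj_leg x im)).
Qed.

Lemma caterpillar_binary_caterpillar : binary_caterpillar caterpillar.
Proof.
split; first exact: caterpillar_binary.
pose p := mkseq (fun i => cv i.*2.+1) m.+1.
have in_p i : i <= m -> cv i.*2.+1 \in p.
  by move=> im; apply/mapP; exists i; rewrite ?mem_iota.
exists (cv 0), p; split.
- apply/(pathP (cv 0)) => i; rewrite size_mkseq => im; rewrite nth_mkseq //.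
  case: i im => [|i] im; first by have := caterpillar_adj0 (cv 1); rewrite inE eqxx.
  rewrite [nth _ _ _]/= nth_mkseq; last by lia.
  by rewrite caterpillar_adj_spine // !inE doubleS eqxx !orbT.
- rewrite cons_uniq; apply/andP; split.
    apply/negP => /mapP[i]; rewrite mem_iota => im /eqP.
    by rewrite (inj_in_eq cv_inj) ?inE; lia.
  apply/mkseq_uniqP => i j; rewrite !inE => im jm /eqP.
  by rewrite (inj_in_eq cv_inj) ?inE; lia.
move=> v; case: (caterpillar_cases v) => [->|[i im ->]|->|[i im ->]] nv.
- by rewrite inE eqxx in nv.
- by rewrite inE in_p ?orbT // ltnW in nv.
- by rewrite inE in_p ?orbT in nv.
exists (cv i.*2.+1); first by rewrite inE in_p ?orbT // ltnW.
rewrite caterpillar_adj_leg // inE; apply/eqP; congr cv; rewrite /cat_par; lia.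
Qed.

Lemma caterpillar_shape : branch_shape (cv 0) (cv 1) (comb m).
Proof.
have a01 : adj (cv 0) (cv 1) by rewrite caterpillar_adj0 inE.
exact: (comb_shape cv_inj a01 caterpillar_adj_spine caterpillar_adj_end
                  caterpillar_adj_leg (i := 0) (add0n m)).
Qed.

Lemma caterpillar_ecc (v : caterpillar) : ecc v <= ecc (cv 0).
Proof.
have t := caterpillar_is_tree; have [_ conn _] := t.
have s := caterpillar_shape; have a := shape_adj s.
have a' : adj (cv 1) (cv 0) by rewrite adj_sym.
have s' : branch_shape (cv 1) (cv 0) Leaf.
  by split=> // x; rewrite caterpillar_adj0 inE.
rewrite (ecc_shape t s' s) max0n depth_comb; apply: ecc_leq => u.
have cases w : w \in branch (cv 0) (cv 1) \/ w = cv 0.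
  have [|] := boolP (w \in branch (cv 0) (cv 1)); first by left.
  by rewrite -in_setC -branchC // (branch_leaf t s') => /set1P; right.
have d0 w : w \in branch (cv 0) (cv 1) -> dist w (cv 0) <= m.+1.
  move=> wb; have := shape_depth_le t s wb; move: wb; rewrite in_branch // => /eqP->.
  by rewrite depth_comb.
case: (cases u) (cases v) => [ub|->] [vb|->].
- exact: comb_diam s u v ub vb.
- exact: d0.
- by rewrite dist_sym // d0.
by rewrite dist_xx.
Qed.
End Caterpillar.

(** * The concrete crg trees *)

Section Crg.
Variables k m : nat.
Hypothesis k_gt0 : 0 < k.

Definition crg := glue (hv k 0) (cv m 0).

Lemma crg_is_tree : is_tree crg.
Proof. exact: glue_is_tree (heap_parent k) (caterpillar_parent m). Qed.

Let fh v : crg := inl (hv k v).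
Let fc v : crg := glue_r (hv k 0) (cv m 0) (cv m v).

Let fc0 : fc 0 = fh 0. Proof. exact: glue_r_root. Qed.

Let cv_neq0 v : 0 < v -> v <= m.*2.+1 -> cv m v != cv m 0.
Proof. by move=> v0 vm; rewrite eq_cv // cvK // -lt0n. Qed.

Let hv_neq0 v : 0 < v -> v <= k.*2 -> hv k v != hv k 0.
Proof. by move=> v0 vk; rewrite eq_hv // hvK // -lt0n. Qed.

Let adj_root x : adj (fh 0) x = (x \in [:: fc 1; fh 1; fh 2]).
Proof.
exact: (glue_adj_root (fun u => heap_adj_root u k_gt0) (@caterpillar_adj0 m)).
Qed.

Lemma crg_cat_shape : branch_shape (fh 0) (fc 1) (comb m).
Proof.
rewrite -fc0; apply: (@comb_shape crg fc m _ _ _ _ _ 0 m).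
- by move=> u v um vm /glue_r_inj; apply: cv_inj.
- by rewrite fc0 adj_root inE eqxx.
- move=> i x im; apply: (glue_adj_r (s := [:: _; _; _])); first by apply: cv_neq0; lia.
  by move=> u; apply: caterpillar_adj_spine.
- move=> x; apply: (glue_adj_r (s := [:: _])); first by apply: cv_neq0; lia.
  exact: caterpillar_adj_end.
- move=> i x im; apply: (glue_adj_r (s := [:: _])); first by apply: cv_neq0; lia.
  by move=> u; apply: caterpillar_adj_leg.
by [].
Qed.

Lemma crg_heap_shape : branch_shape (fc 1) (fh 0) (heapt k k 0).
Proof.
have inr1 : exists z, fc 1 = inr z.
  have c1 : cv m 1 != cv m 0 by apply: cv_neq0.
  by exists (Sub (cv m 1) c1); rewrite -glue_rE.
apply: (@heap_shape crg (fc 1) fh k _ _ _ _ _ _ _ k 0) => //.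
- move=> u v; rewrite !inE => uk vk [] /eqP.
  by rewrite eq_hv // hvK // => /eqP.
- by case: inr1 => z ->.
- by rewrite adj_sym adj_root inE eqxx.
- move=> v x vk; apply: (glue_adj_l (s := [:: _; _; _])); first by apply: hv_neq0; lia.
  have E : hv k v = v :> nat by apply: hvK; lia.
  by move=> u; rewrite heap_adj_internal E.
- move=> v x v0 /andP[kv vk]; apply: (glue_adj_l (s := [:: _])).
    by apply: hv_neq0; lia.
  have E : hv k v = v :> nat by apply: hvK; lia.
  by move=> u; rewrite heap_adj_leaf E.
by rewrite subn0.
Qed.

Lemma card_crg : #|crg| = (k + m).+1.*2.
Proof.
rewrite /= card_sum card_sig card_ord.
rewrite (eq_card (B := predC1 (cv m 0))) // cardC1 card_ord /=; lia.
Qed.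

(** Read off from vertex counts: the two branches at the joining edge partition [crg], and the comb
    side is known. *)
Lemma leaves_heapt : leaves (heapt k k 0) = k.+1.
Proof.
have := shape_card crg_is_tree crg_heap_shape.
have := shape_card crg_is_tree crg_cat_shape; rewrite leaves_comb.
rewrite (branchC crg_is_tree (shape_adj crg_cat_shape)).
have := cardsC (branch (fh 0) (fc 1)); rewrite card_crg; clear; lia.
Qed.

Lemma crgP : crg_tree (k + m).+1.*2 k.*2.+1 crg.
Proof.
split; rewrite /= ?odd_double //; try lia.
exists (heap k), (hv k 0), (caterpillar m), (cv m 0); split.
- by split; [apply: heap_rgood | rewrite card_ord].
- by split; [apply: caterpillar_binary_caterpillar | rewrite card_ord; lia].
- exact: caterpillar_ecc.
by exists id => //; exists id.
Qed.

Lemma crg_center_core_dist t t' D : leaves t' = k.+1 -> leaves t = m.+1 ->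
  weight t < weight t' -> depth t' + 2 * D <= (depth t).+1 ->
  D <= center_core_dist crg.
Proof.
move=> lt' lt w d; have [->//|D0] := posnP D.
have [h gh] := good_heap k; have E : leaves (heapt k k 0) = leaves t'.
  by rewrite leaves_heapt lt'.
apply: (leq_center_core_dist crg_is_tree D0 crg_cat_shape crg_heap_shape).
  apply: leq_ltn_trans (weight_ge_comb lt) _; apply: leq_trans w _.
  by apply: good_opt gh _; rewrite E.
have := good_depth_le gh (esym E); have := depth_lt_leaves t; move: d; rewrite lt.
clear; lia.
Qed.
End Crg.

Theorem theorem3p4 (n : nat) (n_ge12 : 12 <= n) (n_even : ~~ odd n) :
  exists Tstar : sgraph,
    (exists l : nat, crg_tree n l Tstar) /\
    (forall T : sgraph, binary_tree T -> #|T| = n ->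
       center_core_dist T <= center_core_dist Tstar).
Proof.
(* A heap with [2k+1] vertices and a caterpillar with [2m+2] share one vertex, so [n] vertices in
   total mean [k + m = N]. *)
pose N := n./2.-1; have En : n = N.+1.*2 by rewrite /N; lia.
clearbody N; have N2 : 1 < N.+1 by lia.
pose F (k : 'I_N.+1) := center_core_dist (crg k (N - k)).
have [k /= k0 max_k] :=
  @arg_maxnP _ (Ordinal N2) (fun k : 'I_N.+1 => 0 < k) F isT.
have kN : k <= N by rewrite -ltnS.
exists (crg k (N - k)); split.
  by exists (k.*2.+1); rewrite En -{1}(subnKC kN); apply: crgP.
move=> T bT cardT; have [->//|D0] := posnP (center_core_dist T).
have [t [t' [L w d]]] := center_core_shape bT D0.
rewrite cardT En in L; have t0 := leaves_gt0 t.
(* A single leaf has the least weight, so [t'] is a node and the corresponding heap has at least one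
   internal vertex. *)
have t'1 : 1 < leaves t'.
  case: t' w {L d} => [|a b] /=; first by have := weight_ge2 t; lia.
  by have := leaves_gt0 a; have := leaves_gt0 b; lia.
have jN : (leaves t').-1 < N.+1 by lia.
apply: leq_trans (max_k (Ordinal jN) _); last by rewrite /=; lia.
by apply: (@crg_center_core_dist _ _ _ t t') => //=; lia.
Qed.
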